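(* There is a constant $C$ such that for every $N$ and every two binary strings $a,b$ of length at most $N$ there exists a binary string $f$ of length exactly $\mathrm{KS}(b\mid a)$ such that $$\mathrm{KS}(b\mid f,a)\le C\log N\quad\text{and}\quad \bigl|\mathrm{KS}(b\mid f)-\min\{\mathrm{KS}(a),\mathrm{KS}(b)\}\bigr|\le C\log N.$$
   Context: $\mathrm{KS}(u)$ and $\mathrm{KS}(u\mid v)$ denote plain and conditional Kolmogorov complexity of binary strings with respect to a fixed optimal programming language; conditioning on two strings means conditioning on an encoding of the pair. *)

(* Defs.v *)
From mathcomp Require Import all_boot.
From Stdlib Require Import ClassicalEpsilon.
Set Implicit Arguments. Unset Strict Implicit. Unset Printing Implicit Defensive.

Definition cpair (x y : nat) : nat := ((x + y) * (x + y).+1)./2 + y.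

Inductive code : Type :=
| CZero | CSucc | CId | CFst | CSnd
| CComp of code & code
| CPair of code & code
| CRec  of code & code
| CMin  of code.

Inductive eval : code -> nat -> nat -> Prop :=
| ev_zero x : eval CZero x 0
| ev_succ x : eval CSucc x x.+1
| ev_id x : eval CId x x
| ev_fst x y : eval CFst (cpair x y) x
| ev_snd x y : eval CSnd (cpair x y) y
| ev_comp f g x y z : eval g x y -> eval f y z -> eval (CComp f g) x z
| ev_pair f g x y z : eval f x y -> eval g x z -> eval (CPair f g) x (cpair y z)
| ev_rec0 f g x y : eval f x y -> eval (CRec f g) (cpair x 0) y
| ev_recS f g x n y z :
    eval (CRec f g) (cpair x n) y -> eval g (cpair x (cpair n y)) z ->
    eval (CRec f g) (cpair x n.+1) z
| ev_min f x n :
    eval f (cpair x n) 0 ->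
    (forall m, m < n -> exists k, eval f (cpair x m) k.+1) ->
    eval (CMin f) x n.

(* Bijective encoding of binary strings as naturals. *)
Fixpoint enc (s : seq bool) : nat :=
  match s with
  | [::] => 0
  | b :: s' => (enc s').*2 + 1 + b
  end.

(* A (conditional) programming language: program, condition |-> output. *)
Definition lang := seq bool -> seq bool -> option (seq bool).

Definition computable_lang (D : lang) : Prop :=
  exists e : code, forall p y v,
    eval e (cpair (enc p) (enc y)) v <-> exists z, D p y = Some z /\ v = enc z.

Definition optimal_lang (U : lang) : Prop :=
  computable_lang U /\
  forall D : lang, computable_lang D ->
    exists c : nat, forall p y x, D p y = Some x ->
      exists p', size p' <= size p + c /\ U p' y = Some x.

Definition is_KS (U : lang) (x y : seq bool) (n : nat) : Prop :=
  (exists p, size p = n /\ U p y = Some x) /\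
  (forall p, U p y = Some x -> n <= size p).

Definition KSc (U : lang) (x y : seq bool) : nat :=
  epsilon (inhabits 0) (is_KS U x y).

Definition KS (U : lang) (x : seq bool) : nat := KSc U x [::].

(* Computable injective encoding of a pair of strings as one string. *)
Definition pair_str (f a : seq bool) : seq bool :=
  flatten (map (fun b => [:: b; b]) f) ++ [:: false; true] ++ a.

(* Main.v *)
(* Let k = KS(b|a) and let p be a shortest program for b given a.  Take f = phi_i(a, p), where
   each phi_i(a, .) is a permutation of {0,1}^k and i ranges over poly(N) values, so that f and
   p determine each other given a and O(log N) bits.  The family phi is the first one, in a
   brute-force search, such that every set S of fewer than 2^(k-1) strings of length k contains
   all phi_i(a, p) for at most |S| pairs (a, p); independent random permutations have this
   property with positive probability.

   Suppose KS(b|f) <= t for f = phi_i(a, p) and all i, with t slightly below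
   min(KS(a), KS(b)), and let N_t(b) be the set of f of length k with KS(b|f) <= t.  There are
   at most 2^(k+t+1) pairs (f, b) with f in N_t(b).  If N_t(b) contains half of the strings of
   length k, then b is one of O(2^t) enumerable strings, and KS(b) is too small.  Otherwise
   (a, p) belongs to an enumerable set X which, by expansion, has at most 2^(k+t+1) elements.
   Let r be slightly below k.  If a has at least 2^r partners in X, it is one of at most
   2^(k+t+1-r) such strings, and KS(a) is too small; if it has fewer, p has a rank below 2^r
   given a, and KS(b|a) < k. *)
Require Import Defs.
From mathcomp Require Import all_boot.
From mathcomp Require Import perm fingroup zify.
From Stdlib Require Import ClassicalEpsilon Classical.
Set Implicit Arguments. Unset Strict Implicit. Unset Printing Implicit Defensive.

(** * The Cantor pairing and its inverse *)

Lemma cpair0S y : cpair y.+1 0 = (cpair 0 y).+1.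
Proof. rewrite /cpair; lia. Qed.

Lemma cpairSS x y : cpair x y.+1 = (cpair x.+1 y).+1.
Proof. rewrite /cpair addSnnS; lia. Qed.

Lemma cpair_surj z : exists w : nat * nat, cpair w.1 w.2 == z.
Proof.
elim: z => [|z [[x y] /= /eqP <-]]; first by exists (0, 0).
case: x => [|x]; last by exists (x, y.+1); rewrite cpairSS.
by exists (y.+1, 0); rewrite cpair0S.
Qed.

Lemma cpair_inj x y x' y' : cpair x y = cpair x' y' -> x = x' /\ y = y'.
Proof.
have mono s t : s < t -> (s * s.+1)./2 + s < (t * t.+1)./2.
  by move=> st; have := leq_mul st (st : s.+2 <= t.+1); lia.
have sumE : cpair x y = cpair x' y' -> x + y = x' + y'.
  rewrite /cpair => e.
  by case: (ltngtP (x + y) (x' + y')) => // /mono; lia.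
by move=> e; move: (sumE e) (e); rewrite /cpair => ->; lia.
Qed.

Definition unpair z : nat * nat := xchoose (cpair_surj z).
Definition ufst z := (unpair z).1.
Definition usnd z := (unpair z).2.

Lemma unpairK z : cpair (ufst z) (usnd z) = z.
Proof. exact/eqP/(xchooseP (cpair_surj z)). Qed.

Lemma ufstK x y : ufst (cpair x y) = x.
Proof. by have [] := cpair_inj (unpairK (cpair x y)). Qed.

Lemma usndK x y : usnd (cpair x y) = y.
Proof. by have [] := cpair_inj (unpairK (cpair x y)). Qed.

(** * Total computable functions *)

Definition tc (f : nat -> nat) := exists c, forall x, eval c x (f x).

Lemma tc_ext f g : f =1 g -> tc g -> tc f.
Proof. by move=> fg [c hc]; exists c => x; rewrite fg. Qed.

Lemma tc_id : tc (fun x => x).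
Proof. by exists CId => x; constructor. Qed.

Lemma tc_app f g : tc f -> tc g -> tc (fun x => f (g x)).
Proof. by move=> [c hc] [d hd]; exists (CComp c d) => x; econstructor. Qed.

Lemma tc_fst f : tc f -> tc (fun x => ufst (f x)).
Proof.
by apply: tc_app; exists CFst => x; rewrite -{1}(unpairK x); constructor.
Qed.

Lemma tc_snd f : tc f -> tc (fun x => usnd (f x)).
Proof.
by apply: tc_app; exists CSnd => x; rewrite -{1}(unpairK x); constructor.
Qed.

Lemma tc_pair f g : tc f -> tc g -> tc (fun x => cpair (f x) (g x)).
Proof. by move=> [c hc] [d hd]; exists (CPair c d) => x; constructor. Qed.

Lemma tc_S f : tc f -> tc (fun x => (f x).+1).
Proof. by apply: tc_app; exists CSucc => x; constructor. Qed.

Lemma tc_const n : tc (fun=> n).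
Proof.
by elim: n => [|n IH]; [exists CZero => x; constructor | apply: tc_S].
Qed.

Lemma tc_rec (n a : nat -> nat) (s : nat -> nat -> nat -> nat) :
  tc n -> tc a ->
  tc (fun z => s (ufst z) (ufst (usnd z)) (usnd (usnd z))) ->
  tc (fun x => nat_rect (fun=> nat) (a x) (s x) (n x)).
Proof.
move=> hn [ca ha] [cs hs].
pose F z := nat_rect (fun=> nat) (a (ufst z)) (s (ufst z)) (usnd z).
suff tF : tc F.
  apply: (@tc_ext _ (fun x => F (cpair x (n x)))).
    by move=> x; rewrite /F ufstK usndK.
  exact: (tc_app tF (tc_pair tc_id hn)).
exists (CRec ca cs) => z; rewrite -(unpairK z) /F ufstK usndK.
elim: (usnd z) => [|m IH]; first by apply: ev_rec0.
apply: ev_recS IH _.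
by have := hs (cpair (ufst z) (cpair m (nat_rect (fun=> nat) (a (ufst z)) (s (ufst z)) m)));
  rewrite !ufstK !usndK !ufstK.
Qed.

Lemma tc_pred f : tc f -> tc (fun x => (f x).-1).
Proof.
apply: tc_app; apply: (@tc_ext _ (fun x => nat_rect (fun=> nat) 0 (fun n _ => n) x)).
  by case.
by apply: (tc_rec (s := fun _ n _ => n)); [exact: tc_id | exact: tc_const | exact: tc_fst (tc_snd tc_id)].
Qed.

Lemma tc_add f g : tc f -> tc g -> tc (fun x => f x + g x).
Proof.
move=> hf hg.
apply: (@tc_ext _ (fun x => nat_rect (fun=> nat) (f x) (fun _ r => r.+1) (g x))).
  by move=> x; elim: (g x) => [|n /= <-]; rewrite ?addn0 ?addnS.
by apply: (tc_rec (s := fun _ _ r => r.+1)) => //; exact: tc_S (tc_snd (tc_snd tc_id)).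
Qed.

Lemma tc_sub f g : tc f -> tc g -> tc (fun x => f x - g x).
Proof.
move=> hf hg.
apply: (@tc_ext _ (fun x => nat_rect (fun=> nat) (f x) (fun _ r => r.-1) (g x))).
  by move=> x; elim: (g x) => [|n /= <-]; rewrite ?subn0 ?subnS.
by apply: (tc_rec (s := fun _ _ r => r.-1)) => //; exact: tc_pred (tc_snd (tc_snd tc_id)).
Qed.

Lemma tc_mul f g : tc f -> tc g -> tc (fun x => f x * g x).
Proof.
move=> hf hg.
apply: (@tc_ext _ (fun x => nat_rect (fun=> nat) 0 (fun _ r => r + f x) (g x))).
  by move=> x; elim: (g x) => [|n /= <-]; rewrite ?muln0 ?mulnS 1?addnC.
apply: (tc_rec (s := fun x _ r => r + f x)) => //; first exact: tc_const.
exact: tc_add (tc_snd (tc_snd tc_id)) (tc_app hf (tc_fst tc_id)).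
Qed.

Lemma tc_exp f g : tc f -> tc g -> tc (fun x => f x ^ g x).
Proof.
move=> hf hg.
apply: (@tc_ext _ (fun x => nat_rect (fun=> nat) 1 (fun _ r => r * f x) (g x))).
  by move=> x; elim: (g x) => [|n /= <-]; rewrite ?expn0 ?expnSr.
apply: (tc_rec (s := fun x _ r => r * f x)) => //; first exact: tc_const.
exact: tc_mul (tc_snd (tc_snd tc_id)) (tc_app hf (tc_fst tc_id)).
Qed.

Lemma tc_not P : tc (fun x => nat_of_bool (P x)) -> tc (fun x => nat_of_bool (~~ P x)).
Proof.
move=> hP; apply: (@tc_ext _ (fun x => 1 - P x)); first by move=> x; case: (P x).
exact: tc_sub (tc_const 1) hP.
Qed.

Lemma tc_and P Q : tc (fun x => nat_of_bool (P x)) -> tc (fun x => nat_of_bool (Q x)) ->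
  tc (fun x => nat_of_bool (P x && Q x)).
Proof.
move=> hP hQ; apply: (@tc_ext _ (fun x => P x * Q x)).
  by move=> x; case: (P x); case: (Q x).
exact: tc_mul.
Qed.

Lemma tc_leq f g : tc f -> tc g -> tc (fun x => nat_of_bool (f x <= g x)).
Proof.
move=> hf hg; apply: (@tc_ext _ (fun x => 1 - (f x - g x))).
  by move=> x; rewrite -subn_eq0; case: (f x - g x).
exact: tc_sub (tc_const 1) (tc_sub hf hg).
Qed.

Lemma tc_eq f g : tc f -> tc g -> tc (fun x => nat_of_bool (f x == g x)).
Proof.
move=> hf hg; apply: (@tc_ext _ (fun x => (f x <= g x) && (g x <= f x))).
  by move=> x; rewrite eqn_leq.
by apply: tc_and; exact: tc_leq.
Qed.

(* [if] under a function symbol, so that [tc_step] can match on it. *)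
Definition ifb (b : bool) (x y : nat) := if b then x else y.

Lemma tc_if P f g : tc (fun x => nat_of_bool (P x)) -> tc f -> tc g ->
  tc (fun x => ifb (P x) (f x) (g x)).
Proof.
move=> hP hf hg; apply: (@tc_ext _ (fun x => P x * f x + ~~ P x * g x)).
  by move=> x; rewrite /ifb; case: (P x); rewrite !mul0n ?mul1n ?addn0.
by apply: tc_add; apply: tc_mul => //; apply: tc_not.
Qed.

Lemma tc_count (n : nat -> nat) (P : nat -> nat -> bool) : tc n ->
  tc (fun z => nat_of_bool (P (ufst z) (usnd z))) ->
  tc (fun x => count (P x) (iota 0 (n x))).
Proof.
move=> hn hP.
apply: (@tc_ext _ (fun x => nat_rect (fun=> nat) 0 (fun j r => r + P x j) (n x))).
  move=> x; elim: (n x) => // m IH.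
  by rewrite -addn1 iotaD count_cat IH addn1 /= add0n addn0.
apply: (tc_rec (s := fun x j r => r + P x j)) => //; first exact: tc_const.
apply: tc_add; first exact: tc_snd (tc_snd tc_id).
apply: (@tc_ext _ (fun z => P (ufst (cpair (ufst z) (ufst (usnd z))))
                          (usnd (cpair (ufst z) (ufst (usnd z)))))).
  by move=> z; rewrite ufstK usndK.
exact: (tc_app hP (tc_pair (tc_fst tc_id) (tc_fst (tc_snd tc_id)))).
Qed.

Lemma tc_has (n : nat -> nat) (P : nat -> nat -> bool) : tc n ->
  tc (fun z => nat_of_bool (P (ufst z) (usnd z))) ->
  tc (fun x => nat_of_bool (has (P x) (iota 0 (n x)))).
Proof.
move=> hn hP; apply: (@tc_ext _ (fun x => 1 <= count (P x) (iota 0 (n x)))).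
  by move=> x; rewrite has_count.
by apply: tc_leq (tc_const 1) _; apply: tc_count.
Qed.

Lemma tc_all (n : nat -> nat) (P : nat -> nat -> bool) : tc n ->
  tc (fun z => nat_of_bool (P (ufst z) (usnd z))) ->
  tc (fun x => nat_of_bool (all (P x) (iota 0 (n x)))).
Proof.
move=> hn hP; apply: (@tc_ext _ (fun x => ~~ has (fun j => ~~ P x j) (iota 0 (n x)))).
  by move=> x; rewrite -all_predC; congr nat_of_bool; apply: eq_all => j /=; rewrite negbK.
by apply: tc_not; apply: tc_has => //; apply: tc_not.
Qed.

Lemma tc_find (n : nat -> nat) (P : nat -> nat -> bool) : tc n ->
  tc (fun z => nat_of_bool (P (ufst z) (usnd z))) ->
  tc (fun x => find (P x) (iota 0 (n x))).
Proof.
move=> hn hP.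
(* The running value [r] equals [j] exactly while no index below [j] satisfies [P]; once a hit is
   found, [r] falls behind and stays frozen. *)
pose s x j r := ifb (r == j) (r + ~~ P x j) r.
apply: (@tc_ext _ (fun x => nat_rect (fun=> nat) 0 (s x) (n x))).
  move=> x; elim: (n x) => // m IH.
  rewrite -addn1 iotaD find_cat has_find !size_iota IH addn1 /= add0n /s /ifb.
  have := find_size (P x) (iota 0 m); rewrite IH size_iota.
  by case: ltngtP => // -> _; case: (P x m).
apply: tc_rec => //; first exact: tc_const.
have hs1 : tc (fun z => nat_of_bool (P (ufst (cpair (ufst z) (ufst (usnd z))))
                          (usnd (cpair (ufst z) (ufst (usnd z)))))).
  exact: (tc_app hP (tc_pair (tc_fst tc_id) (tc_fst (tc_snd tc_id)))).
apply: tc_if; [apply: tc_eq|apply: tc_add|]; try exact: tc_snd (tc_snd tc_id).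
  exact: tc_fst (tc_snd tc_id).
by apply: tc_not; apply: tc_ext hs1 => z; rewrite ufstK usndK.
Qed.

Lemma count_lt n m : count (fun j => j < m) (iota 0 n) = minn n m.
Proof.
elim: n => [|n IH]; first by rewrite min0n.
by rewrite -addn1 iotaD count_cat IH /= add0n addn0; lia.
Qed.

Lemma tc_div f g : tc f -> tc g -> tc (fun x => f x %/ g x).
Proof.
move=> hf hg.
(* The quotient counts the [q] with [q.+1 * g x <= f x]. A zero divisor is treated apart, since
   every [q] would then be counted while [divn] returns 0. *)
apply: (@tc_ext _ (fun x => ifb (0 < g x)
          (count (fun q => q.+1 * g x <= f x) (iota 0 (f x))) 0)).
  move=> x; rewrite /ifb; case: posnP => [->|g0]; first by rewrite divn0.
  under eq_count => q do rewrite -leq_divRL //.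
  by rewrite count_lt; apply/esym/minn_idPr/leq_div.
apply: tc_if (tc_leq (tc_const 1) hg) _ (tc_const 0).
apply: tc_count => //; apply: tc_leq; first apply: tc_mul.
- exact: tc_S (tc_snd tc_id).
- exact: tc_app hg (tc_fst tc_id).
- exact: tc_app hf (tc_fst tc_id).
Qed.

Lemma tc_mod f g : tc f -> tc g -> tc (fun x => f x %% g x).
Proof.
move=> hf hg; apply: (@tc_ext _ (fun x => f x - f x %/ g x * g x)).
  by move=> x; rewrite {2}(divn_eq (f x) (g x)) addKn.
by apply: tc_sub => //; apply: tc_mul => //; apply: tc_div.
Qed.

Lemma tc_app2 F f g : tc (fun z => F (ufst z) (usnd z)) -> tc f -> tc g ->
  tc (fun x => F (f x) (g x)).
Proof.
move=> hF hf hg; apply: tc_ext (tc_app hF (tc_pair hf hg)) => x.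
by rewrite ufstK usndK.
Qed.

Lemma tc_app4 (R : nat -> nat -> nat -> nat -> bool) f g h k :
  tc (fun z => nat_of_bool (R (ufst (ufst z)) (usnd (ufst z)) (ufst (usnd z)) (usnd (usnd z)))) ->
  tc f -> tc g -> tc h -> tc k -> tc (fun x => nat_of_bool (R (f x) (g x) (h x) (k x))).
Proof.
move=> hR hf hg hh hk.
apply: tc_ext (tc_app hR (tc_pair (tc_pair hf hg) (tc_pair hh hk))) => x.
by rewrite !(ufstK, usndK).
Qed.

(** Syntax-directed: second-order patterns recover the subterms as functions of the bound variable.
    The last cases apply hypotheses about abstract functions, stated on uncurried arguments. *)
Ltac tc_step :=
  cbv beta; match goal with
  | |- tc (fun x => x) => exact: tc_id
  | |- tc (fun=> ?n) => exact: (tc_const n)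
  | |- tc (fun x => ufst (@?f x)) => refine (tc_fst (f := f) _)
  | |- tc (fun x => usnd (@?f x)) => refine (tc_snd (f := f) _)
  | |- tc (fun x => cpair (@?f x) (@?g x)) => refine (tc_pair (f := f) (g := g) _ _)
  | |- tc (fun x => S (@?f x)) => refine (tc_S (f := f) _)
  | |- tc (fun x => predn (@?f x)) => refine (tc_pred (f := f) _)
  | |- tc (fun x => addn (@?f x) (@?g x)) => refine (tc_add (f := f) (g := g) _ _)
  | |- tc (fun x => subn (@?f x) (@?g x)) => refine (tc_sub (f := f) (g := g) _ _)
  | |- tc (fun x => muln (@?f x) (@?g x)) => refine (tc_mul (f := f) (g := g) _ _)
  | |- tc (fun x => expn (@?f x) (@?g x)) => refine (tc_exp (f := f) (g := g) _ _)
  | |- tc (fun x => divn (@?f x) (@?g x)) => refine (tc_div (f := f) (g := g) _ _)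
  | |- tc (fun x => modn (@?f x) (@?g x)) => refine (tc_mod (f := f) (g := g) _ _)
  | |- tc (fun x => nat_of_bool (negb (@?P x))) => refine (tc_not (P := P) _)
  | |- tc (fun x => nat_of_bool (andb (@?P x) (@?Q x))) => refine (tc_and (P := P) (Q := Q) _ _)
  | |- tc (fun x => nat_of_bool (leq (@?f x) (@?g x))) => refine (tc_leq (f := f) (g := g) _ _)
  | |- tc (fun x => nat_of_bool (eq_op (@?f x) (@?g x))) => refine (tc_eq (f := f) (g := g) _ _)
  | |- tc (fun x => nat_of_bool (has (@?P x) (iota 0 (@?n x)))) => refine (tc_has (n := n) (P := P) _ _)
  | |- tc (fun x => nat_of_bool (all (@?P x) (iota 0 (@?n x)))) => refine (tc_all (n := n) (P := P) _ _)
  | |- tc (fun x => count (@?P x) (iota 0 (@?n x))) => refine (tc_count (n := n) (P := P) _ _)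
  | |- tc (fun x => find (@?P x) (iota 0 (@?n x))) => refine (tc_find (n := n) (P := P) _ _)
  | |- tc (fun x => ifb (@?P x) (@?f x) (@?g x)) => refine (tc_if (P := P) (f := f) (g := g) _ _ _)
  | |- tc (fun x => nat_rect _ (@?a x) (@?s x) (@?n x)) => refine (tc_rec (n := n) (a := a) (s := s) _ _ _)
  | |- _ => assumption
  | H : tc (fun z => ?F (ufst z) (usnd z)) |- tc (fun x => ?F (@?f x) (@?g x)) =>
      refine (tc_app2 (F := F) (f := f) (g := g) H _ _)
  | H : tc ?F |- tc (fun x => ?F (@?f x)) => refine (tc_app (f := F) (g := f) H _)
  | H : tc (fun z => nat_of_bool (?R (ufst (ufst z)) _ _ _)) |-
      tc (fun x => nat_of_bool (?R (@?f x) (@?g x) (@?h x) (@?k x))) =>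
      refine (tc_app4 (R := R) (f := f) (g := g) (h := h) (k := k) H _ _ _ _)
  end.
Ltac tc_auto := repeat tc_step.

(** * Stage-by-stage evaluation *)

(* [F s x] is [v.+1] if the code outputs [v] on [x] within [s] steps, else 0. *)
Definition stage_of (e : code) (F : nat -> nat -> nat) :=
  [/\ tc (fun z => F (ufst z) (usnd z)),
      forall s s' x v, s <= s' -> F s x = v.+1 -> F s' x = v.+1 &
      forall x v, eval e x v <-> exists s, F s x = v.+1].

(** By monotonicity the maximum of finitely many stages serves for all. It is needed for the tests
    below a minimum and later for the finitely many seeds. *)
Lemma common_stage (P : nat -> nat -> Prop) n :
  (forall m s s', s <= s' -> P m s -> P m s') ->
  (forall m, m < n -> exists s, P m s) -> exists s, forall m, m < n -> P m s.
Proof.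
move=> mono; elim: n => [|n IH] h; first by exists 0.
have [m mn|s hs] := IH; first by apply: h; lia.
have [s' hs'] := h n (leqnn _); exists (maxn s s') => m.
rewrite ltnS leq_eqVlt => /orP[/eqP->|mn].
  exact: mono (leq_maxr _ _) hs'.
exact: mono (leq_maxl _ _) (hs _ mn).
Qed.

Lemma stage_total e f : tc f -> (forall x v, eval e x v <-> v = f x) ->
  exists F, stage_of e F.
Proof.
move=> hf he; exists (fun _ x => (f x).+1); split=> // [|x v].
  by apply: tc_S; tc_auto.
rewrite he; split=> [->|[_ [->]]] //; by exists 0.
Qed.

Definition rec_stage (Ff Fg : nat -> nat -> nat) s x n :=
  nat_rect (fun=> nat) (Ff s x)
    (fun n r => ifb (r == 0) 0 (Fg s (cpair x (cpair n r.-1)))) n.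

(** The values 0 (unfinished) and 1 (output 0) both stop the search, so it never skips an undecided
    test; the result is accepted only if the test there is known to output 0. *)
Definition min_stage (Ff : nat -> nat -> nat) s x :=
  let n := find (fun m => Ff s (cpair x m) <= 1) (iota 0 s) in
  ifb (Ff s (cpair x n) == 1) n.+1 0.

Lemma eval_recE f g z v : eval (CRec f g) z v ->
  match usnd z with
  | 0 => eval f (ufst z) v
  | n.+1 => exists2 y, eval (CRec f g) (cpair (ufst z) n) y
                     & eval g (cpair (ufst z) (cpair n y)) v
  end.
Proof.
move=> h; inversion h; subst; rewrite usndK ufstK //.
by exists y.
Qed.

Lemma stage_rec f g Ff Fg : stage_of f Ff -> stage_of g Fg ->
  stage_of (CRec f g) (fun s z => rec_stage Ff Fg s (ufst z) (usnd z)).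
Proof.
move=> [tf mf ef] [tg mg eg]; split.
- rewrite /rec_stage; tc_auto.
- move=> s s' z v ss; rewrite /rec_stage; elim: (usnd z) v => [|n IH] v /=.
    exact: mf.
  rewrite {1}/ifb; case: eqP => // /eqP; rewrite -lt0n => r0 e.
  by rewrite (IH _ (esym (prednK r0))) /= (mg _ _ _ _ ss e).
- move=> z; rewrite -(unpairK z); move: (ufst z) (usnd z) => x n v.
  rewrite ufstK usndK; elim: n v => [|n IH] v; split.
  + by move/eval_recE; rewrite ufstK usndK => /ef.
  + by move=> [s /= hs]; apply/ev_rec0/ef; exists s.
  + move/eval_recE; rewrite ufstK usndK => -[y /IH [s hs] /eg [s' hs']].
    exists (maxn s s').
    have mono : rec_stage Ff Fg (maxn s s') x n = y.+1.
      move: (hs); rewrite /rec_stage.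
      elim: (n) (y) => [|k IHk] w /=; first exact: mf (leq_maxl _ _).
      rewrite {1}/ifb; case: eqP => // /eqP; rewrite -lt0n => r0 e.
      by rewrite (IHk _ (esym (prednK r0))) /= (mg _ _ _ _ (leq_maxl s s') e).
    rewrite /rec_stage /= -/(rec_stage _ _ _ _ _) mono /=.
    exact: mg (leq_maxr _ _) hs'.
  + move=> [s]; rewrite /rec_stage /= -/(rec_stage _ _ _ _ _) /ifb.
    case: eqP => // /eqP; rewrite -lt0n => r0 hs.
    have hg : eval g (cpair x (cpair n (rec_stage Ff Fg s x n).-1)) v by apply/eg; exists s.
    by apply: ev_recS hg; apply/IH; exists s; rewrite (prednK r0).
Qed.

Lemma min_stageP F s x v :
  reflect (v < s.+1 /\ F s (cpair x v) = 1 /\ forall m, m < v -> 1 < F s (cpair x m))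
    (min_stage F s x == v.+1).
Proof.
rewrite /min_stage; set P := fun m => _; set n := find _ _.
have lt_n m : m < n -> 1 < F s (cpair x m).
  move=> mn; have := before_find 0 mn; rewrite nth_iota ?add0n => [/negbT|].
    by rewrite -ltnNge.
  by apply: leq_trans mn _; rewrite -[X in _ <= X](size_iota 0 s) find_size.
have ns : n <= s by rewrite -[X in _ <= X](size_iota 0 s) find_size.
rewrite /ifb; case: (F s (cpair x n) =P 1) => hn; apply: (iffP eqP) => //.
- by case=> <-; rewrite ltnS; do !split.
- move=> [vs [hv lt_v]]; congr _.+1; case: (ltngtP n v) => //.
    by move/lt_v; rewrite hn.
  by move/lt_n; rewrite hv.
- move=> [vs [hv lt_v]]; case: (ltngtP n v) => [nv|/lt_n|nv].
  + have : n < s by lia.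
    rewrite -{1}(size_iota 0 s) -has_find => hP.
    have := nth_find 0 hP; rewrite -/n nth_iota ?add0n; last by lia.
    by rewrite /P leqNgt lt_v.
  + by rewrite hv.
  + by rewrite nv in hn.
Qed.

Lemma eval_compE f g x v : eval (CComp f g) x v -> exists2 y, eval g x y & eval f y v.
Proof. by move=> h; inversion h; subst; exists y. Qed.

Lemma eval_pairE f g x v : eval (CPair f g) x v ->
  exists y z, [/\ eval f x y, eval g x z & v = cpair y z].
Proof. by move=> h; inversion h; subst; exists y, z. Qed.

Lemma eval_minE f x n : eval (CMin f) x n ->
  eval f (cpair x n) 0 /\ forall m, m < n -> exists k, eval f (cpair x m) k.+1.
Proof. by move=> h; inversion h. Qed.

Lemma stage_min f F : stage_of f F -> stage_of (CMin f) (min_stage F).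
Proof.
move=> [tf mf ef]; split.
- rewrite /min_stage; tc_auto.
- move=> s s' x v ss /eqP/min_stageP [vs [hv lt_v]].
  apply/eqP/min_stageP; split; first by lia.
  split=> [|m /lt_v]; first exact: mf ss hv.
  by case e : (F s _) => [|k] // k0; rewrite (mf _ _ _ _ ss e).
- move=> x v; split=> [/eval_minE[/ef[s0 h0] hm]|[s /eqP/min_stageP[vs [hv lt_v]]]].
    have [|m mv|s1 h1] := @common_stage (fun m s => 1 < F s (cpair x m)) v.
    + move=> m s s' ss; case e : (F s _) => [|k] //.
      by rewrite (mf _ _ _ _ ss e).
    + by have [k /ef[s e]] := hm m mv; exists s; rewrite e.
    exists (maxn v (maxn s0 s1)); apply/eqP/min_stageP; split; first by lia.
    split=> [|m /h1]; first by apply: mf h0; lia.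
    case e : (F s1 _) => [|k] //.
    by rewrite (mf s1 (maxn v (maxn s0 s1)) _ _ _ e) //; lia.
  apply: ev_min => [|m /lt_v]; first by apply/ef; exists s.
  by case e : (F s _) => [|[|k]] // _; exists k; apply/ef; exists s.
Qed.

(** Induction on the code, composing the stage functions of the subcodes. It makes halting
    enumerable by decidable stages and yields determinism of [eval]. *)
Lemma stage_exists e : exists F, stage_of e F.
Proof.
elim: e => [|||||f [Ff hf] g [Fg hg]|f [Ff hf] g [Fg hg]|f [Ff hf] g [Fg hg]|f [Ff hf]].
- apply: (@stage_total _ (fun=> 0)); first exact: tc_const.
  by move=> x v; split=> [h|->]; [inversion h | constructor].
- apply: (@stage_total _ (fun x => x.+1)); first exact: tc_S tc_id.
  by move=> x v; split=> [h|->]; [inversion h | constructor].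
- apply: (@stage_total _ (fun x => x)); first exact: tc_id.
  by move=> x v; split=> [h|->]; [inversion h | constructor].
- apply: (@stage_total _ ufst); first exact: tc_fst tc_id.
  move=> x v; split=> [h|->]; first by inversion h; rewrite ufstK.
  by rewrite -{1}(unpairK x); constructor.
- apply: (@stage_total _ usnd); first exact: tc_snd tc_id.
  move=> x v; split=> [h|->]; first by inversion h; rewrite usndK.
  by rewrite -{1}(unpairK x); constructor.
- case: hf hg => [tf mf ef] [tg mg eg].
  exists (fun s x => ifb (Fg s x == 0) 0 (Ff s (Fg s x).-1)); split; first by tc_auto.
    move=> s s' x v ss; case e : (Fg s x) => [|y] //= h.
    by rewrite (mg _ _ _ _ ss e) /= (mf _ _ _ _ ss h).
  move=> x v; split=> [/eval_compE[y /eg[s e] /ef[s' e']]|[s]].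
    exists (maxn s s'); rewrite (mg _ _ _ _ (leq_maxl _ _) e) /=.
    exact: mf (leq_maxr _ _) e'.
  case e : (Fg s x) => [|y] //= h.
  by apply: (ev_comp (y := y)); [apply/eg; exists s | apply/ef; exists s].
- case: hf hg => [tf mf ef] [tg mg eg].
  exists (fun s x => ifb ((Ff s x == 0) || (Fg s x == 0)) 0 (cpair (Ff s x).-1 (Fg s x).-1).+1).
  split.
  + apply: (@tc_ext _ (fun z => ifb (~~ (Ff (ufst z) (usnd z) == 0) && ~~ (Fg (ufst z) (usnd z) == 0))
       (cpair (Ff (ufst z) (usnd z)).-1 (Fg (ufst z) (usnd z)).-1).+1 0)); last by tc_auto.
    by move=> z; case: (Ff _ _); case: (Fg _ _).
  + move=> s s' x v ss; case e : (Ff s x) => [|y] //; case e' : (Fg s x) => [|y'] //= h.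
    by rewrite (mf _ _ _ _ ss e) (mg _ _ _ _ ss e') /=.
  + move=> x v; split=> [/eval_pairE[y [z [/ef[s e] /eg[s' e'] ->]]]|[s]].
      exists (maxn s s'); rewrite (mf _ _ _ _ (leq_maxl _ _) e) /=.
      by rewrite (mg _ _ _ _ (leq_maxr _ _) e').
    case e : (Ff s x) => [|y] //; case e' : (Fg s x) => [|y'] //= [<-].
    by apply: ev_pair; [apply/ef; exists s | apply/eg; exists s].
- by exists (fun s z => rec_stage Ff Fg s (ufst z) (usnd z)); apply: stage_rec.
- by exists (min_stage Ff); apply: stage_min.
Qed.

Lemma eval_det e x v v' : eval e x v -> eval e x v' -> v = v'.
Proof.
have [F [_ mono he]] := stage_exists e.
move=> /he[s es] /he[s' es'].
have := mono _ (maxn s s') _ _ (leq_maxl _ _) es.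
by rewrite (mono _ (maxn s s') _ _ (leq_maxr _ _) es') => -[].
Qed.

(** Unbounded search is [CMin] applied to the negation of [P], because [CMin] looks for the value 0.
    No witness has to exist for other inputs, so the code may be partial. *)
Lemma search_code (P : nat -> nat -> bool) h :
  tc (fun z => nat_of_bool (P (ufst z) (usnd z))) ->
  tc (fun z => h (ufst z) (usnd z)) ->
  exists e, forall x w, P x w -> (forall w', w' < w -> ~~ P x w') -> eval e x (h x w).
Proof.
move=> /tc_not [c hc] [d hd].
exists (CComp d (CPair CId (CMin c))) => x w Pw ltP.
apply: (ev_comp (y := cpair x w)); last by have := hd (cpair x w); rewrite ufstK usndK.
apply: ev_pair; first exact: ev_id.
apply: ev_min => [|m mw]; first by have := hc (cpair x w); rewrite ufstK usndK Pw.
by exists 0; have := hc (cpair x m); rewrite ufstK usndK ltP.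
Qed.

Lemma tc_search (P : nat -> nat -> bool) :
  tc (fun z => nat_of_bool (P (ufst z) (usnd z))) ->
  (forall x, exists w, P x w) -> exists2 h, tc h & forall x, P x (h x).
Proof.
move=> tP exP; have [e he] := @search_code P (fun _ w => w) tP (tc_snd tc_id).
exists (fun x => ex_minn (exP x)) => [|x]; last by case: ex_minnP.
exists e => x; case: ex_minnP => w Pw minw; apply: he => // w' ww'.
by apply: contraL ww' => /minw; rewrite -leqNgt.
Qed.

(** * Strings as numbers *)

Lemma enc_surj n : exists s, enc s == n.
Proof.
elim/ltn_ind: n => -[|n] IH; first by exists [::].
have [|s /eqP es] := IH n./2; first by lia.
by exists (odd n :: s) => /=; rewrite es; lia.
Qed.

Definition dec n : seq bool := xchoose (enc_surj n).

Lemma decK n : enc (dec n) = n.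
Proof. exact/eqP/(xchooseP (enc_surj n)). Qed.

Lemma enc_inj : injective enc.
Proof.
elim=> [|b s IH] [|b' s'] //=; try lia.
move=> e; have ebb : b = b' by case: b e; case: b'; lia.
by rewrite ebb (IH s') //; move: e; rewrite ebb; lia.
Qed.

(** [(enc s).+1] has as binary digits, from the lowest, the bits of [s] and then a leading 1. So the
    strings of length [n] have the consecutive codes from [2 ^ n - 1] on. *)
Lemma size_enc s : 2 ^ size s <= (enc s).+1 < 2 ^ (size s).+1.
Proof.
elim: s => [|b s] //=; rewrite !expnS => /andP[h1 h2].
by apply/andP; split; case: b; lia.
Qed.

Lemma size_encE s n : (size s == n) = (2 ^ n <= (enc s).+1 < 2 ^ n.+1).
Proof.
have /andP[h1 h2] := size_enc s.
apply/eqP/idP => [<-|/andP[h3 h4]]; first by rewrite h1 h2.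
have := leq_ltn_trans h1 h4; have := leq_ltn_trans h3 h2.
by rewrite !ltn_exp2l // !ltnS => ? ?; apply/eqP; rewrite eqn_leq; apply/andP.
Qed.

Lemma size_enc_le s n : (size s <= n) = ((enc s).+1 < 2 ^ n.+1).
Proof.
have /andP[h1 h2] := size_enc s; apply/idP/idP => [sn|h].
  by apply: leq_trans h2 _; rewrite leq_exp2l.
by rewrite -ltnS -(@ltn_exp2l 2) //; apply: leq_ltn_trans h1 h.
Qed.

Lemma ufst_le z : ufst z <= z.
Proof. by rewrite -{2}(unpairK z) /cpair; move: (ufst z) (usnd z) => x y; nia. Qed.

(* The number [2 ^ w * (2 * (u + 2 ^ w * j) + 1)] with [u < 2 ^ w] carries the pair [(u, j)]
   and is only polynomial in [u] times larger than [j]. *)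
Definition hdr P := count (fun i => P %% 2 ^ i.+1 == 0) (iota 0 P).
Definition parU P := (P %/ 2 ^ (hdr P).+1) %% 2 ^ hdr P.
Definition parJ P := (P %/ 2 ^ (hdr P).+1) %/ 2 ^ hdr P.

Lemma tc_hdr : tc hdr. Proof. rewrite /hdr; tc_auto. Qed.
Lemma tc_parU : tc parU. Proof. have := tc_hdr; rewrite /parU => ?; tc_auto. Qed.
Lemma tc_parJ : tc parJ. Proof. have := tc_hdr; rewrite /parJ => ?; tc_auto. Qed.

Lemma par_exists u j r : j < 2 ^ r ->
  exists p, [/\ parU (enc p) = u, parJ (enc p) = j &
                size p <= r + (2 * trunc_log 2 u + 3)].
Proof.
move=> jr; pose w := (trunc_log 2 u).+1.
have uw : u < 2 ^ w by apply: trunc_log_ltn.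
pose P := 2 ^ w * (2 * (u + 2 ^ w * j)).+1.
(* [hdr P] counts the positive powers of 2 that divide [P], so it is the 2-adic valuation; the
   second factor of [P] is odd. *)
have hP : hdr P = w.
  rewrite /hdr.
  have P0 : 0 < P by rewrite muln_gt0 expn_gt0.
  have lP : logn 2 P = w.
    rewrite lognM ?expn_gt0 // pfactorK // [X in _ + X](_ : _ = 0) ?addn0 //.
    by apply/eqP; rewrite lognE /= dvdn2 /= oddM.
  under eq_count => i do rewrite -/(dvdn _ _) pfactor_dvdn // lP.
  rewrite count_lt; apply/minn_idPr.
  by apply: leq_trans (ltnW (ltn_expl w (isT : 1 < 2))) _; apply: leq_pmulr.
have hD : P %/ 2 ^ w.+1 = u + 2 ^ w * j.
  by rewrite expnS /P (mulnC 2 (2 ^ w)) divnMA mulKn ?expn_gt0 //; lia.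
exists (dec P); rewrite decK /parU /parJ hP hD; split.
- by rewrite addnC mulnC modnMDl modn_small.
- by rewrite addnC mulnC divnMDl ?expn_gt0 // divn_small // addn0.
- rewrite size_enc_le decK.
  have -> : (r + (2 * trunc_log 2 u + 3)).+1 = r + w + w.+2 by rewrite /w; lia.
  have b : u + 2 ^ w * j < 2 ^ (r + w).
    rewrite addnC expnD mulnC; have := leq_mul jr (leqnn (2 ^ w)); lia.
  have w0 : 0 < 2 ^ w by rewrite expn_gt0.
  rewrite (expnD 2 (r + w)) (expnS 2 w.+1) (expnS 2 w) /P.
  move: b w0; set y := u + _; set A := 2 ^ (r + w); set x := 2 ^ w => yA x0.
  have := leq_mul yA (leqnn x); nia.
Qed.

(** * Kolmogorov complexity *)

Section Complexity.
Variables (U : lang) (hU : optimal_lang U).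

Lemma KSc_code e : exists c, forall p y x,
  eval e (cpair (enc p) (enc y)) (enc x) ->
  exists2 p', size p' <= size p + c & U p' y = Some x.
Proof.
pose G p y := exists x, eval e (cpair (enc p) (enc y)) (enc x).
(* Every number is the code of a string, so a code becomes a language by classically choosing the
   decoded output; determinism makes the choice unique. *)
pose D : lang := fun p y =>
  if excluded_middle_informative (G p y) is left h
  then Some (proj1_sig (constructive_indefinite_description _ h)) else None.
have DP p y z : D p y = Some z <-> eval e (cpair (enc p) (enc y)) (enc z).
  rewrite /D; case: excluded_middle_informative => [h|nh].
    case: constructive_indefinite_description => x /= hx.
    split=> [[<-] //|hz].
    by rewrite (enc_inj (eval_det hx hz)).
  by split=> // hz; case: nh; exists z.
have cD : computable_lang D.
  exists e => p y v; split=> [h|[z [/DP h ->]] //].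
  by exists (dec v); rewrite decK; split=> //; apply/DP; rewrite decK.
have [_ /(_ D cD) [c hc]] := hU; exists c => p y x /DP /hc [p' [sp Up]].
by exists p'.
Qed.

(** The language that outputs its own program describes every string, so a least length exists and
    [epsilon] never returns an arbitrary value. *)
Lemma KScP x y : is_KS U x y (KSc U x y).
Proof.
apply: epsilon_spec.
have [c hc] := KSc_code CFst.
have [|p _ Up] := hc x y x; first by constructor.
pose P n := excluded_middle_informative (exists p, size p = n /\ U p y = Some x) : bool.
have PP n : P n <-> exists p, size p = n /\ U p y = Some x.
  by rewrite /P; case: excluded_middle_informative.
have exP : exists n, P n by exists (size p); apply/PP; exists p.
case: (ex_minnP exP) => n /PP hn minn; exists n; split=> // q Uq.
by apply/minn/PP; exists q.
Qed.

Lemma KSc_min p x y : U p y = Some x -> KSc U x y <= size p.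
Proof. by have [_] := KScP x y; apply. Qed.

Lemma KSc_size : exists c, forall x y, KSc U x y <= size x + c.
Proof.
have [c hc] := KSc_code CFst; exists c => x y.
have [|p sp /KSc_min] := hc x y x; first by constructor.
by move/leq_trans; apply.
Qed.

(* The program describes [x] by the parameter [u] and the rank of [x] in the order of
   enumeration. *)
Lemma enum_KSc (R : nat -> nat -> nat -> nat -> bool) :
  tc (fun z => nat_of_bool (R (ufst (ufst z)) (usnd (ufst z)) (ufst (usnd z)) (usnd (usnd z)))) ->
  (forall s s' u y x, s <= s' -> R s u y x -> R s' u y x) ->
  exists c, forall s u y x r, R s u (enc y) (enc x) ->
    (forall s l, uniq l -> all (R s u (enc y)) l -> size l <= 2 ^ r) ->
    KSc U x y <= r + 2 * trunc_log 2 u + c.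
Proof.
move=> tR mono.
pose Rz z w := R (ufst w) (parU (ufst z)) (usnd z) (usnd w).
(* A number [w] codes a stage and a candidate. Only the first [w] for each candidate is new, so
   counting the new ones gives the rank of a candidate. *)
pose new z w := Rz z w && ~~ has (fun w' => Rz z w' && (usnd w' == usnd w)) (iota 0 w).
pose sel z w := new z w && (count (new z) (iota 0 w) == parJ (ufst z)).
have tU := tc_parU; have tJ := tc_parJ.
have [||e he] := @search_code sel (fun _ => usnd).
- by rewrite /sel /new /Rz; tc_auto.
- by tc_auto.
have [c hc] := KSc_code e; exists (3 + c) => s u y x r Rx cnt.
pose Q w := R (ufst w) u (enc y) (usnd w).
pose nw w := Q w && ~~ has (fun w' => Q w' && (usnd w' == usnd w)) (iota 0 w).
have exw : exists w, Q w && (usnd w == enc x).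
  by exists (cpair s (enc x)); rewrite /Q ufstK usndK Rx eqxx.
case: (ex_minnP exw) => w0 /andP[Q0 /eqP e0] min0.
have nw0 : nw w0.
  rewrite /nw Q0; apply/hasPn => w'; rewrite mem_iota add0n => /andP[_ ww].
  by apply: contraL ww; rewrite e0 -leqNgt => /min0.
pose j := count nw (iota 0 w0).
have jr : j < 2 ^ r.
  (* The candidates found up to [w0] are distinct and all satisfy [R] at stage [w0], because a pair
     bounds its first component; hence the rank is below [2 ^ r]. *)
  have -> : j.+1 = size [seq usnd w | w <- iota 0 w0.+1 & nw w].
    by rewrite size_map size_filter -[w0.+1]addn1 iotaD count_cat /= add0n nw0 addn0 addn1.
  apply: (cnt w0).
    rewrite map_inj_in_uniq ?filter_uniq ?iota_uniq // => w w'.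
    rewrite !mem_filter => /andP[nww _] /andP[nww' _] ee.
    have lt_neq v v' : nw v -> nw v' -> usnd v = usnd v' -> v < v' -> False.
      move=> /andP[Qv _] /andP[_ /hasPn h] ev vv.
      have := h v; rewrite mem_iota add0n vv => /(_ isT).
      by rewrite Qv ev eqxx.
    by case: (ltngtP w w') => // [/(lt_neq _ _ nww nww' ee)|/(lt_neq _ _ nww' nww (esym ee))].
  apply/allP => v /mapP[w]; rewrite mem_filter mem_iota add0n ltnS => /andP[/andP[Qw _] ww] ->.
  by apply: mono Qw; apply: leq_trans (ufst_le w) ww.
have [p [pu pj sp]] := par_exists u jr.
have newE w : new (cpair (enc p) (enc y)) w = nw w by rewrite /new /Rz ufstK usndK pu.
have sel0 : eval e (cpair (enc p) (enc y)) (enc x).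
  rewrite -e0; apply: he => [|w' ww].
    by rewrite /sel newE nw0 (eq_count newE) ufstK pj eqxx.
  rewrite /sel newE (eq_count newE) ufstK pj; apply/negP => /andP[nw' /eqP ej].
  (* An earlier new [w'] has rank below [j], since [j] counts [w'] as well; so the search cannot
     stop before [w0]. *)
  have : j = count nw (iota 0 w') + (1 + count nw (iota w'.+1 (w0 - w'.+1))).
    have -> : 1 + count nw (iota w'.+1 (w0 - w'.+1)) = count nw (iota w' (w0 - w')).
      by rewrite -(subnSK ww) /= nw'.
    by rewrite -count_cat -{2}[w']add0n -iotaD subnKC // ltnW.
  lia.
have [p' sp' /KSc_min] := hc _ _ _ sel0; lia.
Qed.

End Complexity.

(** * A random family of permutations expands *)

Section PermCount.
Variables (T : finType) (S : {set T}).
Hypothesis small_S : 2 * #|S| <= #|T|.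

Definition perms_into (P : {set T}) := [set s : {perm T} | [forall x in P, s x \in S]].

(** Composing with the transposition of [p] and [x] exchanges their images and leaves those of [P]
    alone: all points outside [P] are equally likely to land in [S]. *)
Lemma perms_into_swap (P : {set T}) p x : p \notin P -> x \notin P ->
  #|[set s in perms_into P | s x \in S]| = #|perms_into (p |: P)|.
Proof.
move=> pP xP; rewrite -(card_imset _ (mulgI (tperm p x))); congr #|pred_of_set _|.
have fixP y : y \in P -> tperm p x y = y.
  by move=> yP; rewrite tpermD //; [apply: contraNneq pP | apply: contraNneq xP] => ->.
apply/setP => s; apply/imsetP/idP => [[s' ]|].
  rewrite !inE => /andP[/forall_inP h hx] ->; apply/forall_inP => y.
  rewrite !inE permM => /orP[/eqP->|yP]; first by rewrite tpermL.
  by rewrite fixP // h.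
rewrite inE => /forall_inP h; exists (tperm p x * s)%g.
  rewrite !inE permM tpermR h ?setU11 // andbT; apply/forall_inP => y yP.
  by rewrite permM fixP // h // setU1r.
by rewrite mulgA tperm2 mul1g.
Qed.

(** Double counting over the points outside [P]: a permutation sending [P] into [S] sends at most
    [#|S| - #|P|] of the other [#|T| - #|P|] points into [S], at most half of them. *)
Lemma perms_into_half (P : {set T}) p : p \notin P ->
  2 * #|perms_into (p |: P)| <= #|perms_into P|.
Proof.
move=> pP.
have cP : #|~: P| = #|T| - #|P| by rewrite -(cardsC P) addKn.
have cP0 : 0 < #|~: P| by apply/card_gt0P; exists p; rewrite inE.
have e1 : \sum_(x in ~: P) #|[set s in perms_into P | s x \in S]|
        = #|~: P| * #|perms_into (p |: P)|.
  rewrite -sum_nat_const; apply: eq_bigr => x; rewrite inE.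
  exact: perms_into_swap.
have e2 : \sum_(x in ~: P) #|[set s in perms_into P | s x \in S]|
        <= #|perms_into P| * (#|S| - #|P|).
  under eq_bigr => x _ do rewrite -sum1_card.
  rewrite (exchange_big_dep (mem (perms_into P))) /=; last first.
    by move=> x s _; rewrite inE => /andP[].
  rewrite -sum_nat_const; apply: leq_sum => s sP; rewrite sum1dep_card.
  have sPS : s @: P \subset S.
    apply/subsetP => _ /imsetP[y yP ->].
    by move: sP; rewrite inE => /forall_inP; apply.
  rewrite -(card_imset P (@perm_inj _ s)) -(card_imset _ (@perm_inj _ s)).
  rewrite -(setIidPr sPS) -cardsD.
  apply/subset_leq_card/subsetP => z /imsetP[x]; rewrite !inE => /andP[xP /andP[_ xS]] ->.
  rewrite xS andbT; apply: contra xP => /imsetP[y yP].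
  by move/perm_inj ->.
rewrite -(leq_pmul2l cP0) mulnCA -e1.
apply: (@leq_trans (2 * (#|perms_into P| * (#|S| - #|P|)))).
  by rewrite leq_mul2l.
rewrite mulnCA (mulnC _ #|perms_into P|) leq_mul2l cP; apply/orP; right; lia.
Qed.

Lemma card_perms_into (P : {set T}) : 2 ^ #|P| * #|perms_into P| <= #|{perm T}|.
Proof.
have [n] := ubnP #|P|; elim: n P => // n IH P.
case: (set_0Vmem P) => [->|[p pP]]; first by rewrite cards0 mul1n max_card.
rewrite (cardsD1 p) pP add1n ltnS => /IH; apply: leq_trans.
rewrite expnSr -mulnA leq_mul2l; apply/orP; right.
by rewrite -{1}(setD1K pP) perms_into_half // setD11.
Qed.

End PermCount.

Lemma leq_bin_exp n m : 'C(n, m) <= n ^ m.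
Proof.
elim: n m => [|n IH] [|m]; rewrite ?bin0 ?expn0 ?bin0n //.
rewrite binS; apply: leq_trans (leq_add (IH _) (IH _)) _.
by rewrite expnS -mulSnr expnS leq_mul2l; case: (posnP m) => [->|m0] //; rewrite leq_exp2r ?leqnSn.
Qed.

Lemma leq_card_bigcup (I T : finType) (P : pred I) (F : I -> {set T}) :
  #|\bigcup_(i | P i) F i| <= \sum_(i | P i) #|F i|.
Proof.
elim/big_rec2: _ => [|i n A _ IH]; first by rewrite cards0.
by apply: leq_trans (leq_card_setU _ _) _; rewrite leq_add2l.
Qed.

Section Expander.
Variables (M A : nat) (W : finType).
Implicit Types (S : {set W}) (X : {set 'I_A * W}).
Local Notation K := #|W|.
Local Notation fam := {ffun 'I_M * 'I_A -> {perm W}}.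

Definition captured (pi : fam) S := [set v | [forall i, pi (i, v.1) v.2 \in S]].

(** The permutations are independent: each of the [M] permutations for [a] maps the section of [X]
    at [a] into [S] with probability at most [2 ^ - #|sec a|], and the exponents add up to
    [M * #|X|]. *)
Lemma card_capturing S X : 2 * #|S| <= K ->
  (2 ^ M) ^ #|X| * #|[set pi : fam | X \subset captured pi S]| <= #|{: fam}|.
Proof.
move=> hS; pose sec a := [set p | (a, p) \in X].
have cX : #|X| = \sum_a #|sec a|.
  rewrite -sum1_card (partition_big fst predT) //=.
  apply: eq_bigr => a _; rewrite -sum1_card.
  rewrite (reindex_onto (pair a) snd) /=; last by move=> [b p] /= /andP[_ /eqP ->].
  by apply: eq_bigl => p; rewrite !inE !eqxx !andbT.
have -> : #|[set pi : fam | X \subset captured pi S]|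
        = \prod_(j : 'I_M * 'I_A) #|perms_into S (sec j.2)|.
  have -> : \prod_(j : 'I_M * 'I_A) #|perms_into S (sec j.2)|
      = #|family (fun j : 'I_M * 'I_A => mem (perms_into S (sec j.2)))|.
    by rewrite card_family foldrE big_map big_enum.
  apply: eq_card => pi; rewrite inE; apply/subsetP/familyP => [h [i a]|h [a p] ap].
    rewrite inE; apply/forall_inP => p; rewrite inE => /h.
    by rewrite inE => /forallP /(_ i).
  rewrite inE; apply/forallP => i; have := h (i, a).
  by rewrite inE => /forall_inP; apply; rewrite inE.
have -> : (2 ^ M) ^ #|X| = \prod_(j : 'I_M * 'I_A) 2 ^ #|sec j.2|.
  rewrite -expn_sum -expnM; congr (2 ^ _).
  by rewrite -(pair_bigA _ (fun _ a => #|sec a|)) /= -cX sum_nat_const card_ord.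
rewrite -big_split /= card_ffun -prod_nat_const.
by apply: leq_prod => j _; apply: card_perms_into.
Qed.

(** Union bound. A bad family captures, for some [S] of size [s], a set [X] of [s.+1] pairs. There
    are at most [(A * K * K) ^ s.+1] choices of [S] and [X], so each size spoils at most a fraction
    [1 / K.+1] of the families, and only [K] sizes occur. *)
Lemma expander_exists : 0 < K -> A * K * K * K.+1 <= 2 ^ M ->
  exists pi : fam, forall S, 2 * #|S| < K -> #|captured pi S| <= #|S|.
Proof.
move=> K0 hM; apply: NNPP => no.
have bad (pi : fam) : exists S, exists X,
    [/\ 2 * #|S| < K, #|X| = #|S|.+1 & X \subset captured pi S].
  apply: NNPP => nb; apply: no; exists pi => S hS; rewrite leqNgt; apply/negP => lt.
  apply: nb; exists S.
  have [X /andP[/eqP cX XS]] : exists X, (#|X| == #|S|.+1) && (X \subset captured pi S).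
    have := cards_draws (captured pi S) #|S|.+1.
    have : 0 < 'C(#|captured pi S|, #|S|.+1) by rewrite bin_gt0.
    move=> h0 e; rewrite -e in h0; case/card_gt0P: h0 => X; rewrite inE => /andP[XS cX].
    by exists X; rewrite cX.
  by exists X; split.
pose Bad (s : nat) := \bigcup_(SX : {set W} * {set 'I_A * W} |
     (2 * #|SX.1| < K) && ((#|SX.1| == s) && (#|SX.2| == s.+1)))
     [set pi : fam | SX.2 \subset captured pi SX.1].
have card_Bad s : K.+1 * #|Bad s| <= #|{: fam}|.
  pose np := #|[pred SX : {set W} * {set 'I_A * W} | (#|SX.1| == s) && (#|SX.2| == s.+1)]|.
  have hnp : np <= (A * K * K) ^ s.+1.
    have -> : np = 'C(K, s) * 'C(A * K, s.+1).
      have -> : 'C(A * K, s.+1) = #|[set X : {set 'I_A * W} | #|X| == s.+1]|.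
        by rewrite card_draws card_prod card_ord.
      rewrite -card_draws -cardsX.
      by apply: eq_card => -[S X]; rewrite !inE.
    rewrite mulnC expnMn; apply: leq_mul; first exact: leq_bin_exp.
    apply: leq_trans (leq_bin_exp _ _) _.
    by rewrite leq_pexp2l.
  have hD : (A * K * K) ^ s.+1 * K.+1 <= (2 ^ M) ^ s.+1.
    apply: (@leq_trans ((A * K * K * K.+1) ^ s.+1)); last by rewrite leq_exp2r.
    by rewrite (expnMn (A * K * K)) leq_mul2l -{1}(expn1 K.+1) leq_pexp2l // orbT.
  have D1 : 0 < (2 ^ M) ^ s.+1 by rewrite !expn_gt0.
  rewrite -(leq_pmul2l D1) mulnCA.
  have : (2 ^ M) ^ s.+1 * #|Bad s| <= np * #|{: fam}|.
    apply: leq_trans (leq_mul (leqnn _) (leq_card_bigcup _ _)) _.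
    rewrite big_distrr /=.
    apply: (@leq_trans (\sum_(SX : {set W} * {set 'I_A * W} |
        (2 * #|SX.1| < K) && ((#|SX.1| == s) && (#|SX.2| == s.+1))) #|{: fam}|)).
      apply: leq_sum => -[S X] /= /andP[hS /andP[_ /eqP <-]].
      exact: card_capturing (ltnW hS).
    rewrite sum_nat_const leq_mul2r; apply/orP; right.
    by apply/subset_leq_card/subsetP => SX; rewrite !inE => /andP[].
  move=> h; apply: leq_trans (leq_mul (leqnn K.+1) h) _.
  rewrite mulnA leq_mul2r; apply/orP; right.
  by apply: leq_trans hD; rewrite mulnC leq_mul2r hnp orbT.
have : #|{: fam}| <= \sum_(s < K) #|Bad s|.
  apply: leq_trans (leq_card_bigcup _ _); rewrite -[X in X <= _]cardsT; apply/subset_leq_card/subsetP => pi _.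
  have [S [X [hS cX XS]]] := bad pi.
  have hs : #|S| < K by lia.
  apply/bigcupP; exists (Ordinal hs) => //; apply/bigcupP; exists (S, X); last by rewrite inE.
  by rewrite /= hS cX !eqxx.
rewrite -(leq_pmul2l (ltn0Sn K)) big_distrr /=.
have : \sum_(s < K) K.+1 * #|Bad s| <= K * #|{: fam}|.
  rewrite -[X in X * _](card_ord K) -sum_nat_const; apply: leq_sum => s _; exact: card_Bad.
move=> h1 h2; have := leq_trans h2 h1; rewrite leq_mul2r ltnn orbF => /eqP/card0_eq/(_ [ffun=> 1%g]).
by rewrite inE.
Qed.

End Expander.

(** * Brute-force search for the expander *)

Definition digit B T j := (T %/ B ^ j) %% B.

Lemma digits_exist B n (f : nat -> nat) : 0 < B -> (forall j, j < n -> f j < B) ->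
  exists2 T, T < B ^ n & forall j, j < n -> digit B T j = f j.
Proof.
move=> B0; elim: n => [|n IH] hf; first by exists 0.
have [|T Tn hT] := IH; first by move=> j jn; apply: hf; lia.
exists (T + f n * B ^ n).
  have := hf n (leqnn _); rewrite expnS => fn.
  have := leq_mul fn (leqnn (B ^ n)); lia.
move=> j; rewrite ltnS leq_eqVlt /digit => /orP[/eqP->|jn].
  by rewrite addnC divnMDl ?expn_gt0 ?B0 // divn_small // addn0 modn_small // hf.
rewrite -(subnK jn) addnS -addSn expnD mulnA addnC divnMDl ?expn_gt0 ?B0 //.
by rewrite expnSr mulnA modnMDl -/(digit B T j) hT.
Qed.

Lemma card_ord_count n (P : pred nat) : #|[set x : 'I_n | P x]| = count P (iota 0 n).
Proof.
rewrite cardsE -sum1_card -sum1_count.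
by have := @big_mkord _ 0 addn n P (fun=> 1); rewrite /index_iota subn0 => ->.
Qed.

(** The whole family is a single number [T] in base [K], addressed in mixed radix by seed, condition
    and argument. *)
Definition entry K A T i a p := digit K T ((i * A + a) * K + p).

Definition captured_count K A M T (S : pred nat) :=
  count (fun v => all (fun i => S (entry K A T i (v %/ K) (v %% K))) (iota 0 M))
        (iota 0 (A * K)).

(* Decidable form of the expansion property; the set tested is given by the binary digits
   of [S]. *)
Definition good_table K A M T :=
  all (fun i => all (fun a => all (fun p => all (fun p' =>
      ~~ ((entry K A T i a p == entry K A T i a p') && ~~ (p == p')))
    (iota 0 K)) (iota 0 K)) (iota 0 A)) (iota 0 M)
  && all (fun S => ~~ ((2 * count (fun j => digit 2 S j == 1) (iota 0 K) < K)
      && ~~ (captured_count K A M T (fun j => digit 2 S j == 1)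
             <= count (fun j => digit 2 S j == 1) (iota 0 K)))) (iota 0 (2 ^ K)).

Lemma good_inj K A M T i a p p' : good_table K A M T ->
  i < M -> a < A -> p < K -> p' < K -> entry K A T i a p = entry K A T i a p' -> p = p'.
Proof.
move=> /andP[/allP h _] iM aA pK pK' e.
have := h i; rewrite mem_iota iM => /(_ isT)/allP/(_ a).
rewrite mem_iota aA => /(_ isT)/allP/(_ p).
rewrite mem_iota pK => /(_ isT)/allP/(_ p').
by rewrite mem_iota pK' => /(_ isT); rewrite e eqxx /= negbK => /eqP.
Qed.

Lemma entry_lt K A T i a p : 0 < K -> entry K A T i a p < K.
Proof. by move=> K0; rewrite ltn_mod. Qed.

Lemma good_expands K A M T (S : pred nat) : 0 < K -> good_table K A M T ->
  2 * count S (iota 0 K) < K -> captured_count K A M T S <= count S (iota 0 K).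
Proof.
move=> K0 /andP[_ /allP h] hS.
have [|X XK hX] := @digits_exist 2 K (fun j => S j) isT; first by move=> j _; case: (S j).
have eS j : j < K -> (digit 2 X j == 1) = S j by move=> /hX->; case: (S j).
have := h X; rewrite mem_iota XK => /(_ isT).
have -> : count (fun j => digit 2 X j == 1) (iota 0 K) = count S (iota 0 K).
  by apply: eq_in_count => j; rewrite mem_iota => /eS.
rewrite hS /= negbK; congr (_ <= _); apply: eq_count => v; apply: eq_all => i.
by rewrite eS // entry_lt.
Qed.

Lemma good_exists K A M : 0 < K -> A * K * K * K.+1 <= 2 ^ M -> exists T, good_table K A M T.
Proof.
move=> K0 hM.
have [||pi hpi] := @expander_exists M A 'I_K; rewrite ?card_ord //.
pose idx (v : 'I_M * 'I_A * 'I_K) := (v.1.1 * A + v.1.2) * K + v.2.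
have idx_inj : injective idx.
  move=> [[i a] p] [[i' a'] p'] e.
  have A0 : 0 < A by apply: leq_ltn_trans (ltn_ord a).
  have ep : p = p'.
    by apply/val_inj; have := congr1 (modn^~ K) e; rewrite /idx /= !modnMDl !modn_small.
  have e2 : i * A + a = i' * A + a'.
    by have := congr1 (divn^~ K) e; rewrite /idx /= !divnMDl // !divn_small // !addn0.
  have ea : a = a'.
    by apply/val_inj; have := congr1 (modn^~ A) e2; rewrite /= !modnMDl !modn_small.
  have ei : i = i'.
    apply/val_inj; have := congr1 (divn^~ A) e2.
    by rewrite /= !divnMDl // !divn_small // !addn0.
  by rewrite ep ea ei.
pose f j := if [pick v | idx v == j] is Some v then val (pi v.1 v.2) else 0.
have [|T _ hT] := @digits_exist K (M * A * K) f K0.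
  by move=> j _; rewrite /f; case: pickP => [v _|_] //; apply: ltn_ord.
have entryE (i : 'I_M) (a : 'I_A) (p : 'I_K) : entry K A T i a p = pi (i, a) p.
  have ia : i * A + a < M * A.
    by have := leq_mul (ltn_ord i) (leqnn A); have := ltn_ord a; lia.
  rewrite /entry hT; last by have := leq_mul ia (leqnn K); have := ltn_ord p; lia.
  rewrite /f; case: pickP => [v /eqP|/(_ (i, a, p))]; last by rewrite eqxx.
  by rewrite -[RHS]/(idx (i, a, p)) => /idx_inj ->.
exists T; apply/andP; split.
  apply/allP => i; rewrite mem_iota => /= iM; apply/allP => a; rewrite mem_iota => /= aA.
  apply/allP => p; rewrite mem_iota => /= pK; apply/allP => p'; rewrite mem_iota => /= pK'.
  rewrite (entryE (Ordinal iM) (Ordinal aA) (Ordinal pK)).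
  rewrite (entryE (Ordinal iM) (Ordinal aA) (Ordinal pK')).
  by rewrite negb_and negbK -implybE; apply/implyP => /eqP/val_inj/perm_inj/(congr1 val)/= ->.
apply/allP => X _; rewrite negb_and negbK -implybE; apply/implyP => hX.
set S : pred nat := fun j => _.
have := hpi [set x : 'I_K | S x]; rewrite !card_ord !card_ord_count => /(_ hX).
apply: leq_trans; rewrite /captured_count -card_ord_count.
have divA (v : 'I_(A * K)) : v %/ K < A by rewrite ltn_divLR.
have modK (v : 'I_(A * K)) : v %% K < K by rewrite ltn_mod.
pose g (v : 'I_(A * K)) := (Ordinal (divA v), Ordinal (modK v)).
have g_inj : injective g.
  by move=> v v' [e1 e2]; apply/val_inj; rewrite /= (divn_eq v K) (divn_eq v' K) e1 e2.
rewrite -(card_imset _ g_inj).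
apply/subset_leq_card/subsetP => z /imsetP[v]; rewrite inE => /allP hv ->.
rewrite inE; apply/forallP => i; rewrite inE -entryE.
by apply: hv; rewrite mem_iota add0n ltn_ord.
Qed.

(** With [K = 2 ^ k] and [A = 2 ^ N.+1], the requirement on [M] follows from
    [M = N.+1 + k + k + k.+1]. *)
Definition seeds N k := N + 3 * k + 2.

Lemma good_table_computable : exists2 h, tc h &
  forall N k, good_table (2 ^ k) (2 ^ N.+1) (seeds N k) (h (cpair N k)).
Proof.
pose P z T := good_table (2 ^ usnd z) (2 ^ (ufst z).+1) (seeds (ufst z) (usnd z)) T.
have [||h th hP] := @tc_search P.
- by rewrite /P /good_table /captured_count /entry /digit /seeds; tc_auto.
- move=> z; apply: good_exists; first by rewrite expn_gt0.
  move: (ufst z) (usnd z) => N k.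
  have -> : seeds N k = N.+1 + k + k + k.+1 by rewrite /seeds; lia.
  rewrite !(expnD 2) leq_mul // (expnS 2 k).
  have : 0 < 2 ^ k by rewrite expn_gt0.
  lia.
- by exists h => // N k; have := hP (cpair N k); rewrite /P ufstK usndK.
Qed.

(** * Decoding pairs of strings *)

(* [cpair Y (cpair 2 ^ j F)]: the string still to be parsed, and the code [F] of the [j]
   symbols already read. *)
Definition unpair_step z :=
  let Y := ufst z in let w := ufst (usnd z) in let F := usnd (usnd z) in
  ifb (Y %% 4 == 1) z
    (ifb (Y %% 4 == 3) (cpair ((Y - 3) %/ 4) (cpair (2 * w) (F + w)))
                       (cpair ((Y - 6) %/ 4) (cpair (2 * w) (F + 2 * w)))).

(** [Y] steps suffice: a code is at least the length of the first component, and a state that has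
    reached the separator is a fixed point. *)
Definition unpair_str Y :=
  nat_rect (fun=> nat) (cpair Y (cpair 1 0)) (fun _ z => unpair_step z) Y.
Definition str_fst Y := usnd (usnd (unpair_str Y)).
Definition str_snd Y := (ufst (unpair_str Y) - 5) %/ 4.

Lemma tc_str_fst : tc str_fst.
Proof. by rewrite /str_fst /unpair_str /unpair_step; tc_auto. Qed.

Lemma tc_str_snd : tc str_snd.
Proof. by rewrite /str_snd /unpair_str /unpair_step; tc_auto. Qed.

(** A doubled [false] leaves residue 3 modulo 4 and a doubled [true] residue 2, while the separator
    gives [4 * enc a + 5], residue 1; [unpair_step] tests these residues. *)
Lemma enc_pair_str_cons b f a :
  enc (pair_str (b :: f) a) = 4 * enc (pair_str f a) + (if b then 6 else 3).
Proof. by rewrite /pair_str /=; case: b; lia. Qed.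

Lemma iter_unpair_step f a n w F : size f <= n ->
  iter n unpair_step (cpair (enc (pair_str f a)) (cpair w F))
  = cpair (4 * enc a + 5) (cpair (w * 2 ^ size f) (F + w * enc f)).
Proof.
elim: f n w F => [|b f IH] n w F.
  move=> _; rewrite muln1 muln0 addn0.
  have -> : enc (pair_str [::] a) = 4 * enc a + 5 by rewrite /pair_str /=; lia.
  elim: n => //= n ->; rewrite /unpair_step ufstK.
  by rewrite (_ : (4 * enc a + 5) %% 4 == 1) //; lia.
have size_cons : size (b :: f) = (size f).+1 by [].
have enc_cons : enc (b :: f) = (enc f).*2 + 1 + b by [].
rewrite size_cons; case: n => // n; rewrite ltnS => fn.
rewrite iterSr enc_pair_str_cons {2}/unpair_step !ufstK !usndK ufstK.
set e := enc (pair_str f a) in IH *.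
have -> : ifb ((4 * e + (if b then 6 else 3)) %% 4 == 1)
      (cpair (4 * e + (if b then 6 else 3)) (cpair w F))
      (ifb ((4 * e + (if b then 6 else 3)) %% 4 == 3)
         (cpair ((4 * e + (if b then 6 else 3) - 3) %/ 4) (cpair (2 * w) (F + w)))
         (cpair ((4 * e + (if b then 6 else 3) - 6) %/ 4) (cpair (2 * w) (F + 2 * w))))
  = cpair e (cpair (2 * w) (F + w * b.+1)).
  case: (b).
    have -> : (4 * e + 6) %% 4 = 2 by lia.
    by rewrite /= addnK mulKn // (mulnC w).
  have -> : (4 * e + 3) %% 4 = 3 by lia.
  by rewrite /= addnK mulKn // muln1.
rewrite IH // expnS enc_cons; congr (cpair _ (cpair _ _)); first by lia.
by case: (b); lia.
Qed.

Lemma unpair_strE f a :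
  unpair_str (enc (pair_str f a)) = cpair (4 * enc a + 5) (cpair (2 ^ size f) (enc f)).
Proof.
have iterE n z : nat_rect (fun=> nat) z (fun _ z => unpair_step z) n = iter n unpair_step z.
  by elim: n => //= n ->.
have size_f : size f <= enc (pair_str f a).
  by elim: f => // b f; rewrite enc_pair_str_cons /=; case: b; lia.
by rewrite /unpair_str iterE iter_unpair_step // !mul1n.
Qed.

Lemma str_fstE f a : str_fst (enc (pair_str f a)) = enc f.
Proof. by rewrite /str_fst unpair_strE !usndK. Qed.

Lemma str_sndE f a : str_snd (enc (pair_str f a)) = enc a.
Proof. by rewrite /str_snd unpair_strE ufstK addnK mulKn. Qed.

(** * Counting *)

Lemma count_exchange (Q : nat -> nat -> bool) l s :
  \sum_(b <- l) count (Q b) s = \sum_(v <- s) count (Q^~ v) l.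
Proof.
under eq_bigr => b _ do rewrite -sum1_count big_mkcond.
rewrite exchange_big; apply: eq_bigr => v _.
by rewrite -sum1_count [RHS]big_mkcond.
Qed.

(** Sending each element of [l] to the first [q] that yields it is injective, as [q] yields at most
    one element. *)
Lemma rel_bound (P : pred nat) (Q : nat -> nat -> bool) n l : uniq l ->
  (forall q x x', Q q x -> Q q x' -> x = x') ->
  all (fun x => has (fun q => P q && Q q x) (iota 0 n)) l ->
  size l <= count P (iota 0 n).
Proof.
move=> ul funQ /allP hl.
pose f x := find (fun q => P q && Q q x) (iota 0 n).
have fP x : x \in l -> [/\ f x < n, P (f x) & Q (f x) x].
  move=> /hl h; have := nth_find 0 h; move: h; rewrite has_find size_iota => h.
  by rewrite nth_iota // => /andP[].
rewrite -(size_map f) -size_filter; apply: uniq_leq_size.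
  rewrite map_inj_in_uniq // => x x' /fP[_ _ Qx] /fP[_ _ Qx'] e.
  by apply: funQ Qx _; rewrite e.
by move=> q /mapP[x /fP[fn Pf _] ->]; rewrite mem_filter Pf mem_iota.
Qed.

Lemma size_le_count (Q : nat -> nat -> bool) c s l :
  all (fun b => c <= count (Q b) s) l -> size l * c <= \sum_(b <- l) count (Q b) s.
Proof.
elim: l => [|b l IH] /=; first by rewrite big_nil.
by move=> /andP[hb /IH hl]; rewrite big_cons mulSn leq_add.
Qed.

Lemma count_le_cover (P : pred nat) (Q : nat -> nat -> bool) l s :
  {in s, forall v, P v -> has (Q^~ v) l} ->
  count P s <= \sum_(b <- l) count (fun v => P v && Q b v) s.
Proof.
move=> h; rewrite count_exchange -sum1_count big_mkcond /= big_seq [leqRHS]big_seq.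
apply: leq_sum => v vs; case Pv : (P v) => //=.
by have := h v vs Pv; rewrite has_count.
Qed.

(** * The enumerable set X of captured pairs and its size *)

Section Main.
Variables (h : nat -> nat) (St : nat -> nat -> nat).
Hypothesis tc_h : tc h.
Hypothesis h_good : forall N k, good_table (2 ^ k) (2 ^ N.+1) (seeds N k) (h (cpair N k)).
Hypothesis tc_St : tc (fun z => St (ufst z) (usnd z)).
Hypothesis mono_St : forall s s' x v, s <= s' -> St s x = v.+1 -> St s' x = v.+1.

Lemma St_mono s s' x v : s <= s' -> St s x == v.+1 -> St s' x == v.+1.
Proof. by move=> ss /eqP e; rewrite (mono_St ss e). Qed.

Definition phi N k i a p := entry (2 ^ k) (2 ^ N.+1) (h (cpair N k)) i a p.

(* Strings of length [k] are represented by their rank [f < 2 ^ k], their code being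
   [2 ^ k - 1 + f]; the pair [(a, p)] is represented by [v = enc a * 2 ^ k + p]. *)
Definition Nst t k s b f :=
  has (fun q => St s (cpair q (2 ^ k - 1 + f)) == b.+1) (iota 0 (2 ^ t.+1)).
Definition out k s v := St s (cpair (2 ^ k - 1 + v %% 2 ^ k) (v %/ 2 ^ k)).
Definition Yst N k t s v :=
  ~~ (out k s v == 0) &&
  (all (fun i => Nst t k s (out k s v).-1 (phi N k i (v %/ 2 ^ k) (v %% 2 ^ k)))
       (iota 0 (seeds N k)) &&
   (2 * count (Nst t k s (out k s v).-1) (iota 0 (2 ^ k)) < 2 ^ k)).
(** [Yst] may fail at a later stage, when the neighbourhood of the output has grown to half; the
    union over stages makes the enumeration monotone. *)
Definition Xst N k t s v := has (fun s' => Yst N k t s' v) (iota 0 s.+1).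

Lemma Nst_mono t k s s' b f : s <= s' -> Nst t k s b f -> Nst t k s' b f.
Proof. by move=> ss; apply: sub_has => q; apply: St_mono. Qed.

Lemma Xst_mono N k t s s' v : s <= s' -> Xst N k t s v -> Xst N k t s' v.
Proof.
move=> ss /hasP[s1]; rewrite mem_iota => h1 Y; apply/hasP; exists s1 => //.
by rewrite mem_iota; lia.
Qed.

(** For each of the [2 ^ k] conditions there are fewer than [2 ^ t.+1] programs of length at most
    [t], each with at most one output. *)
Lemma sum_Nst t k s l : uniq l ->
  \sum_(b <- l) count (Nst t k s b) (iota 0 (2 ^ k)) <= 2 ^ k * 2 ^ t.+1.
Proof.
move=> ul; rewrite count_exchange.
apply: (@leq_trans (\sum_(f <- iota 0 (2 ^ k)) 2 ^ t.+1)); last first.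
  by rewrite big_const_seq count_predT size_iota iter_addn_0 mulnC.
apply: leq_sum => f _; rewrite -size_filter -[leqRHS](size_iota 0) -count_predT.
apply: (@rel_bound predT (fun q b => St s (cpair q (2 ^ k - 1 + f)) == b.+1)).
- exact: filter_uniq.
- by move=> q x x' /eqP -> /eqP [].
- by apply/allP => b; rewrite mem_filter => /andP[].
Qed.

Lemma XstP N k t s v : Xst N k t s v -> exists s' b,
  [/\ s' <= s, out k s v = b.+1,
      all (fun i => Nst t k s' b (phi N k i (v %/ 2 ^ k) (v %% 2 ^ k))) (iota 0 (seeds N k)) &
      2 * count (Nst t k s' b) (iota 0 (2 ^ k)) < 2 ^ k].
Proof.
move=> /hasP[s']; rewrite mem_iota add0n ltnS => ss /andP[]; rewrite /out.
case e : (St s' _) => [|b] //= _ /andP[h1 h2]; exists s', b; split=> //.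
exact: mono_St ss e.
Qed.

(** Group the pairs by output [b], and let [s1] be the last stage up to [s] at which the
    neighbourhood of [b] is small. All pairs of the group are captured by the neighbourhood at [s1],
    so expansion bounds their number by its size; then sum over [b]. *)
Lemma card_Xst N k t s :
  count (Xst N k t s) (iota 0 (2 ^ N.+1 * 2 ^ k)) <= 2 ^ k * 2 ^ t.+1.
Proof.
set vs := iota 0 _.
pose l := undup [seq (out k s v).-1 | v <- vs].
apply: leq_trans (sum_Nst t k s (undup_uniq [seq (out k s v).-1 | v <- vs])).
apply: leq_trans (@count_le_cover _ (fun b v => out k s v == b.+1) l _ _) _.
  move=> v vvs /XstP[s' [b [_ e _ _]]]; apply/hasP; exists b; last by rewrite e.
  by rewrite mem_undup; apply/mapP; exists v; rewrite ?e.
apply: leq_sum => b _.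
pose small s' := (s' <= s) && (2 * count (Nst t k s' b) (iota 0 (2 ^ k)) < 2 ^ k).
case: (classic (exists s', small s')) => [ex|nex]; last first.
  rewrite (eq_count (a2 := pred0)) ?count_pred0 // => v.
  apply/negP => /andP[/XstP[s' [b' [ss -> _ sm]]] /eqP[ebb]].
  by apply: nex; exists s'; rewrite /small ss -ebb.
have [|s1 /andP[s1s sm1] max1] := @ex_maxnP small s ex; first by move=> s' /andP[].
have K0 : 0 < 2 ^ k by rewrite expn_gt0.
apply: (@leq_trans (count (Nst t k s1 b) (iota 0 (2 ^ k)))); last first.
  by apply: sub_count => f; apply: Nst_mono.
apply: leq_trans (good_expands K0 (h_good N k) sm1).
apply: sub_count => v /andP[/XstP[s' [b' [ss -> hN sm]]] /eqP[ebb]].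
rewrite ebb in hN sm; apply: sub_all hN => i; apply: Nst_mono.
by apply: max1; rewrite /small ss.
Qed.

(** * Enumerable relations that describe [a] and [b] *)

Definition uN u := ufst (ufst u).
Definition uk u := usnd (ufst u).
Definition ui u := ufst (usnd u).
Definition ut u := usnd (usnd u).
(* The slot [i] also carries the exponent [r] of [heavy_cond], and the slot [t] the length of
   the program for the condition in [decode_prog]. *)
Definition params N k i t := cpair (cpair N k) (cpair i t).

Lemma paramsE N k i t :
  (uN (params N k i t) = N) * (uk (params N k i t) = k) *
  (ui (params N k i t) = i) * (ut (params N k i t) = t).
Proof. by rewrite /uN /uk /ui /ut /params !(ufstK, usndK). Qed.

Definition heavy_out s u (_ x : nat) :=
  2 ^ uk u <= 2 * count (Nst (ut u) (uk u) s x) (iota 0 (2 ^ uk u)).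

Definition pairs u := iota 0 (2 ^ (uN u).+1 * 2 ^ uk u).

Definition Xcond s u a v := Xst (uN u) (uk u) (ut u) s v && (v %/ 2 ^ uk u == a).

Definition heavy_cond s u (_ x : nat) := 2 ^ ui u <= count (Xcond s u x) (pairs u).

Definition light_out s u y x :=
  has (fun v => Xcond s u y v && (out (uk u) s v == x.+1)) (pairs u).

(** From [a] and [f] the program [p] is recovered by inverting the permutation with seed [ui u];
    then [p] is run on [a]. *)
Definition decode s u a f x := (ui u < seeds (uN u) (uk u)) && ((a < 2 ^ (uN u).+1) &&
  has (fun p => (phi (uN u) (uk u) (ui u) a p == f - (2 ^ uk u - 1))
                && (St s (cpair (2 ^ uk u - 1 + p) a) == x.+1)) (iota 0 (2 ^ uk u))).

Definition decode_pair s u y x := decode s u (str_snd y) (str_fst y) x.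

(** The condition [a] is not given but guessed as the output of a program of length at most [ut u]
    on the empty string, whose code is 0. *)
Definition decode_prog s u f x :=
  has (fun q => ~~ (St s (cpair q 0) == 0) && decode s u (St s (cpair q 0)).-1 f x)
      (iota 0 (2 ^ (ut u).+1)).

Definition tc4 (R : nat -> nat -> nat -> nat -> bool) :=
  tc (fun z => nat_of_bool (R (ufst (ufst z)) (usnd (ufst z)) (ufst (usnd z)) (usnd (usnd z)))).

(** * Computability and monotonicity of the relations *)

Lemma tc_heavy_out : tc4 heavy_out.
Proof. by rewrite /tc4 /heavy_out /Nst /uk /ut; tc_auto. Qed.

Lemma tc_heavy_cond : tc4 heavy_cond.
Proof.
by rewrite /tc4 /heavy_cond /Xcond /pairs /Xst /Yst /Nst /out /phi /entry /digit /seeds /uN /uk /ui /ut; tc_auto.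
Qed.

Lemma tc_light_out : tc4 light_out.
Proof.
by rewrite /tc4 /light_out /Xcond /pairs /Xst /Yst /Nst /out /phi /entry /digit /seeds /uN /uk /ut; tc_auto.
Qed.

Lemma tc_decode_pair : tc4 decode_pair.
Proof.
have := tc_str_fst; have := tc_str_snd; rewrite /tc4 /decode_pair => ? ?.
by rewrite /decode /phi /entry /digit /seeds /uN /uk /ui; tc_auto.
Qed.

Lemma tc_decode_prog : tc4 decode_prog.
Proof.
rewrite /tc4 /decode_prog.
by rewrite /decode /phi /entry /digit /seeds /uN /uk /ui /ut; tc_auto.
Qed.

Lemma heavy_out_mono s s' u y x : s <= s' -> heavy_out s u y x -> heavy_out s' u y x.
Proof.
move=> ss; rewrite /heavy_out => /leq_trans; apply; rewrite leq_mul2l; apply/orP; right.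
by apply: sub_count => f; apply: Nst_mono.
Qed.

Lemma Xcond_mono s s' u a v : s <= s' -> Xcond s u a v -> Xcond s' u a v.
Proof. by move=> ss /andP[hX e]; rewrite /Xcond e (Xst_mono ss hX). Qed.

Lemma heavy_cond_mono s s' u y x : s <= s' -> heavy_cond s u y x -> heavy_cond s' u y x.
Proof.
move=> ss /leq_trans; apply; apply: sub_count => v; exact: Xcond_mono.
Qed.

Lemma light_out_mono s s' u y x : s <= s' -> light_out s u y x -> light_out s' u y x.
Proof.
move=> ss; apply: sub_has => v /andP[hX e].
by rewrite (Xcond_mono ss hX) (St_mono ss e).
Qed.

Lemma decode_mono s s' u a f x : s <= s' -> decode s u a f x -> decode s' u a f x.
Proof.
move=> ss /andP[hi /andP[ha hp]]; apply/and3P; split=> //; move: hp; apply: sub_has => p /andP[-> e].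
exact: St_mono ss e.
Qed.

Lemma decode_prog_mono s s' u y x : s <= s' -> decode_prog s u y x -> decode_prog s' u y x.
Proof.
move=> ss; apply: sub_has => q /andP[].
case e : (St s _) => [|v] //= _ /(decode_mono ss) hd.
by rewrite (mono_St ss e).
Qed.

Lemma decode_fun s u a f x x' : decode s u a f x -> decode s u a f x' -> x = x'.
Proof.
move=> /and3P[hi ha /hasP[p]]; rewrite mem_iota => /= hp /andP[/eqP e /eqP ex].
move=> /and3P[_ _ /hasP[p']]; rewrite mem_iota => /= hp' /andP[/eqP e' /eqP ex'].
have epp : p = p' by apply: (good_inj (h_good _ _) hi ha) => //; rewrite -/(phi _ _ _ _ _) e.
by move: ex'; rewrite -epp ex => -[].
Qed.

(** * Bounds on the number of strings satisfying each relation *)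

Lemma heavy_out_card s u y l : uniq l -> all (heavy_out s u y) l -> size l <= 2 ^ (ut u + 2).
Proof.
move=> ul hl; have K0 : 0 < 2 ^ uk u by rewrite expn_gt0.
rewrite -(leq_pmul2l K0) mulnC.
(* Listing the ranks twice turns the factor 2 of [heavy_out] into a plain count. *)
have := @size_le_count (fun b f => Nst (ut u) (uk u) s b f) (2 ^ uk u) (iota 0 (2 ^ uk u) ++ iota 0 (2 ^ uk u)) l.
have -> : all (fun b => 2 ^ uk u <= count (Nst (ut u) (uk u) s b) (iota 0 (2 ^ uk u) ++ iota 0 (2 ^ uk u))) l.
  by apply: sub_all hl => b; rewrite count_cat addnn -mul2n.
move=> /(_ isT) /leq_trans; apply.
under eq_bigr => b _ do rewrite count_cat addnn -mul2n.
rewrite -big_distrr /=; apply: leq_trans (leq_mul (leqnn 2) (sum_Nst _ _ _ ul)) _.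
by rewrite addn2 (expnS 2 (ut u).+1) mulnCA.
Qed.

(** The partners of different conditions are disjoint parts of X, so the size of X is divided by
    [2 ^ ui u]. *)
Lemma heavy_cond_card s u y l : ui u <= uk u -> uniq l -> all (heavy_cond s u y) l ->
  size l <= 2 ^ (ut u + 1 + (uk u - ui u)).
Proof.
move=> ik ul hl; have r0 : 0 < 2 ^ ui u by rewrite expn_gt0.
rewrite -(leq_pmul2r r0) -expnD.
have -> : ut u + 1 + (uk u - ui u) + ui u = uk u + (ut u).+1 by lia.
rewrite expnD; apply: leq_trans (size_le_count hl) _; rewrite count_exchange.
apply: leq_trans (card_Xst (uN u) (uk u) (ut u) s).
rewrite -sum1_count [leqRHS]big_mkcond /=; apply: leq_sum => v _; rewrite /Xcond.
case: ifP => _; last by rewrite count_pred0.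
by rewrite (eq_count (a2 := pred1 (v %/ 2 ^ uk u))) ?count_uniq_mem ?leq_b1 // => a /=; rewrite eq_sym.
Qed.

Lemma light_out_card s u y l : uniq l -> all (light_out s u y) l ->
  size l <= count (Xcond s u y) (pairs u).
Proof.
move=> ul; apply: (rel_bound (Q := fun v x => out (uk u) s v == x.+1)) => //.
by move=> q x x' /eqP -> /eqP[].
Qed.

Lemma decode_pair_card s u y l : uniq l -> all (decode_pair s u y) l -> size l <= 2 ^ 0.
Proof.
move=> ul hl; apply: (@rel_bound predT (fun _ => decode_pair s u y) 1) => //.
  by move=> q x x'; apply: decode_fun.
by apply: sub_all hl => x hx; rewrite /= hx.
Qed.

Lemma decode_prog_card s u y l : uniq l -> all (decode_prog s u y) l ->
  size l <= 2 ^ (ut u).+1.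
Proof.
move=> ul hl; rewrite -[leqRHS](size_iota 0) -count_predT.
apply: (@rel_bound predT (fun q x => ~~ (St s (cpair q 0) == 0) &&
  decode s u (St s (cpair q 0)).-1 y x)) => //.
by move=> q x x' /andP[_ h1] /andP[_ h2]; apply: decode_fun h1 h2.
Qed.

End Main.

(** * The parameters cost O(log N) bits *)

Lemma cpair_lt x y e : x < 2 ^ e -> y < 2 ^ e -> cpair x y < 2 ^ (2 * e + 2).
Proof.
move=> hx hy; rewrite expnD mul2n -addnn expnD /cpair.
set E := 2 ^ e in hx hy *.
have := leq_mul (_ : x + y <= 2 * E - 2) (_ : (x + y).+1 <= 2 * E - 1).
move=> /(_ ltac:(lia) ltac:(lia)); nia.
Qed.

Lemma trunc_log_params c0 : exists L, forall N k i t,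
  2 <= N -> k <= N + c0 -> i <= seeds N k -> t <= N + c0 ->
  2 * trunc_log 2 (params N k i t) <= L * trunc_log 2 N.
Proof.
(* All fields are at most [4 * N + 3 * c0 + 2], hence have at most [e <= (3 * c0 + 8) * n] bits, and
   two levels of pairing give [4 * e + 6] bits. *)
exists (2 * (4 * (3 * c0 + 8) + 6)) => N k i t N2 hk; rewrite /seeds => hi ht.
set n := trunc_log 2 N.
have n1 : 1 <= n by rewrite -(@trunc_expnK 2 1) // leq_trunc_log.
pose e := n.+1 + (3 * c0 + 6).
have big x : x <= 4 * N + 3 * c0 + 2 -> x < 2 ^ e.
  move=> hx; rewrite expnD.
  have h1 : N < 2 ^ n.+1 by apply: trunc_log_ltn.
  have h2 : 3 * c0 + 6 < 2 ^ (3 * c0 + 6) by apply: ltn_expl.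
  have := leq_mul (ltnW h1) (ltnW h2); nia.
have hu : params N k i t < 2 ^ (4 * e + 6).
  have -> : 4 * e + 6 = 2 * (2 * e + 2) + 2 by lia.
  by rewrite /params; apply: cpair_lt; apply: cpair_lt; apply: big; lia.
have hl : trunc_log 2 (params N k i t) <= 4 * e + 6.
  by rewrite -(@trunc_expnK 2 (4 * e + 6)) // leq_trunc_log // ltnW.
have he : e <= (3 * c0 + 8) * n by rewrite /e; nia.
rewrite -mulnA leq_mul2l /=; apply: leq_trans hl _; rewrite mulnDl -mulnA; nia.
Qed.

Lemma scale_bound L c n : 1 <= n -> L * n + c <= (L + c) * n.
Proof. by move=> n1; rewrite mulnDl leq_add2l leq_pmulr. Qed.

(** * The choice of the seed and the complexity bounds *)

Theorem theorem3 (U : lang) (hU : optimal_lang U) :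
  exists C : nat, forall (N : nat) (a b : seq bool),
    2 <= N -> size a <= N -> size b <= N ->
    exists f : seq bool,
      size f = KSc U b a /\
      KSc U b (pair_str f a) <= C * trunc_log 2 N /\
      KSc U b f <= minn (KS U a) (KS U b) + C * trunc_log 2 N /\
      minn (KS U a) (KS U b) <= KSc U b f + C * trunc_log 2 N.
Proof.
have [c0 hc0] := KSc_size hU.
have [L hL] := trunc_log_params c0.
have [[eU heU] _] := hU; have [St [tSt mSt eSt]] := stage_exists eU.
have [h th hg] := good_table_computable.
have UE p y x : U p y = Some x <-> exists s, St s (cpair (enc p) (enc y)) = (enc x).+1.
  rewrite -eSt heU; split=> [e|[z [e /enc_inj ->]]] //; by exists x.
(* This code replaces the condition by 0, the code of the empty string, so that [KS U b] bounds
   [KSc U b f] up to a constant. *)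
have [cW hW] := KSc_code hU (CComp eU (CPair CFst CZero)).
have [cA hA] := enum_KSc hU (tc_heavy_out tSt) (heavy_out_mono mSt).
have [cB hB] := enum_KSc hU (tc_heavy_cond th tSt) (@heavy_cond_mono h St).
have [cD hD] := enum_KSc hU (tc_light_out th tSt) (light_out_mono mSt).
have [cP hP] := enum_KSc hU (tc_decode_pair th tSt) (fun s s' u y x => @decode_mono h St mSt s s' u _ _ x).
have [cQ hQ] := enum_KSc hU (tc_decode_prog th tSt) (decode_prog_mono mSt).
(* [c * n] absorbs the overhead of any one description. The doubled constant leaves a second share
   for the gap between [k] and [r], and [2 * n] makes the contradictions strict. *)
pose c := L + (cW + cA + cB + cD + cP + cQ); exists (2 * c + 2) => N a b N2 aN bN.
set n := trunc_log 2 N; set k := KSc U b a; set m := KS U a; set l := KS U b.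
have n1 : 1 <= n by rewrite -(@trunc_expnK 2 1) // leq_trunc_log.
have kN : k <= N + c0 by apply: leq_trans (hc0 _ _) _; rewrite leq_add2r.
have mN : m <= N + c0 by apply: leq_trans (hc0 _ _) _; rewrite leq_add2r.
have cn : L * n + (cW + cA + cB + cD + cP + cQ) <= c * n by apply: scale_bound.
have -> : (2 * c + 2) * n = 2 * (c * n) + 2 * n by rewrite mulnDl mulnA.
move: cn; move: {c} (c * n) => cn hcn.
have K0 : 0 < 2 ^ k by rewrite expn_gt0.
have [[p [sp Up]] _] := KScP hU b a; rewrite -/k in sp.
have := size_encE p k; rewrite sp eqxx expnS => /esym/andP[kp1 kp2].
pose p1 := enc p - (2 ^ k - 1).
have ep : enc p = 2 ^ k - 1 + p1 by rewrite /p1; lia.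
have p1K : p1 < 2 ^ k by rewrite /p1; lia.
have aA : enc a < 2 ^ N.+1 by move: aN; rewrite size_enc_le; lia.
have [s0 hs0] := (UE p a b).1 Up.
pose v := enc a * 2 ^ k + p1.
have vK : v %/ 2 ^ k = enc a by rewrite divnMDl // divn_small // addn0.
have vp : v %% 2 ^ k = p1 by rewrite modnMDl modn_small.
have vA : v < 2 ^ N.+1 * 2 ^ k by have := leq_mul aA (leqnn (2 ^ k)); rewrite /v; lia.
pose f i := dec (2 ^ k - 1 + phi h N k i (enc a) p1).
have phiK i : phi h N k i (enc a) p1 < 2 ^ k by apply: entry_lt.
have sf i : size (f i) = k.
  by apply/eqP; rewrite size_encE decK expnS; have := phiK i; lia.
have dec_f s u i : s0 <= s -> i < seeds N k -> uN u = N -> uk u = k -> ui u = i ->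
    decode h St s u (enc a) (enc (f i)) (enc b).
  move=> ss hi eN ek ei; rewrite /decode eN ek ei hi aA /=; apply/hasP; exists p1.
    by rewrite mem_iota.
  by rewrite decK addKn eqxx -ep (mSt _ _ _ _ ss hs0) eqxx.
have [i hi hf] : exists2 i, i < seeds N k & minn m l <= KSc U b (f i) + (2 * cn + 2 * n).
  apply: NNPP => no.
  have {}no i : i < seeds N k -> KSc U b (f i) + (2 * cn + 2 * n) < minn m l.
    by move=> hi; rewrite ltnNge; apply/negP => hle; apply: no; exists i.
  pose t := minn m l - (2 * cn + 2 * n) - 1.
  have tE : t + (2 * cn + 2 * n) + 1 <= minn m l.
    by have := no 0 ltac:(rewrite /seeds; lia); rewrite /t; lia.
  have tN : t <= N + c0 by rewrite /t; lia.
  have [s1 hs1] : exists s1, forall i, i < seeds N k ->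
      Nst St t k s1 (enc b) (phi h N k i (enc a) p1).
    apply: common_stage => [i s s' ss|i hi]; first exact: Nst_mono.
    have [[q [sq Uq]] _] := KScP hU b (f i).
    have [s hs] := (UE _ _ _).1 Uq; exists s; apply/hasP; exists (enc q); last first.
      by rewrite decK in hs; rewrite hs.
    have : size q <= t by rewrite sq /t; have := no i hi; lia.
    by rewrite size_enc_le mem_iota /=; lia.
  (* Otherwise [b] is one of at most [2 ^ (t + 2)] enumerable strings, which puts [KS U b] below
     [l]. *)
  have light s : 2 * count (Nst St t k s (enc b)) (iota 0 (2 ^ k)) < 2 ^ k.
    rewrite ltnNge; apply/negP => heavy.
    pose u := params N k 0 t.
    have heavy_b : heavy_out St s u (enc [::]) (enc b) by rewrite /heavy_out !paramsE.
    have := hA s u [::] b (t + 2) heavy_b.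
    have bound s' l' : uniq l' -> all (heavy_out St s' u (enc [::])) l' -> size l' <= 2 ^ (t + 2).
      by move=> ul hl; have := heavy_out_card ul hl; rewrite !paramsE.
    move=> /(_ bound); rewrite -/(KS U b) -/l.
    have := hL N k 0 t N2 kN (leq0n _) tN; rewrite -/n -/u; lia.
  pose s2 := maxn s0 s1.
  pose r := k - (cn + n).
  have Xv u : uN u = N -> uk u = k -> ut u = t -> Xcond h St s2 u (enc a) v.
    move=> eN ek et; rewrite /Xcond eN ek et vK eqxx andbT; apply/hasP; exists s2.
      by rewrite mem_iota; lia.
    rewrite /Yst /out vK vp -ep (mSt s0 _ _ _ (leq_maxl _ _) hs0) /= light andbT.
    apply/allP => i; rewrite mem_iota => /= hi; apply: Nst_mono (hs1 i hi) => //.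
    exact: leq_maxr.
  have rk : r <= k by rewrite /r; lia.
  pose u := params N k r t.
  have ru : r <= seeds N k by rewrite /seeds; lia.
  (* If [a] ever gets [2 ^ r] partners, its rank among such conditions has [t + 1 + (k - r)] bits,
     too few for [KS U a]. *)
  case: (classic (exists s, heavy_cond h St s u 0 (enc a))) => [[s hs]|light_a].
    have bound s' l' : uniq l' -> all (heavy_cond h St s' u (enc [::])) l' ->
        size l' <= 2 ^ (t + 1 + (k - r)).
      by move=> ul hl; have := heavy_cond_card hg mSt _ ul hl; rewrite !paramsE => /(_ rk).
    have := hB s u [::] a (t + 1 + (k - r)) hs bound; rewrite -/(KS U a) -/m.
    have := hL N k r t N2 kN ru tN; rewrite -/n -/u /r; lia.
  have light_s s : count (Xcond h St s u (enc a)) (pairs u) < 2 ^ r.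
    rewrite ltnNge; apply/negP => heavy; apply: light_a; exists s.
    by move: heavy; rewrite /heavy_cond !paramsE.
  have vpairs : v \in pairs u by rewrite mem_iota !paramsE.
  have Xv2 : Xcond h St s2 u (enc a) v by apply: Xv; rewrite paramsE.
  (* The pair [v] is itself a partner, so [2 ^ r] exceeds 1; hence the subtraction in [r] is not
     truncated and [r] lies below [k] by the full [cn + n]. *)
  have r1 : 0 < r.
    have := light_s s2; case: (r) => // ; rewrite expn0 ltnS leqn0 => /eqP e.
    have : has (Xcond h St s2 u (enc a)) (pairs u) by apply/hasP; exists v.
    by rewrite has_count e.
  have light_b : light_out h St s2 u (enc a) (enc b).
    apply/hasP; exists v => //; rewrite Xv2 paramsE /out vK vp -ep.
    by rewrite (mSt s0 _ _ _ (leq_maxl _ _) hs0) eqxx.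
  have bound s' l' : uniq l' -> all (light_out h St s' u (enc a)) l' -> size l' <= 2 ^ r.
    by move=> ul /(light_out_card ul) /leq_trans; apply; apply: ltnW.
  have := hD s2 u a b r light_b bound; rewrite -/k.
  have := hL N k r t N2 kN ru tN; rewrite -/n -/u; move: r1; rewrite /r; lia.
exists (f i); split=> //.
have iS : i <= seeds N k by apply: ltnW.
pose u := params N k i m.
have hu := hL N k i m N2 kN iS mN; rewrite -/n -/u in hu.
have upper_pair : KSc U b (pair_str (f i) a) <= 2 * trunc_log 2 u + cP.
  rewrite -[2 * _]add0n; apply: (hP s0) => [|s' l']; last exact: decode_pair_card.
  by rewrite /decode_pair str_fstE str_sndE; apply: dec_f; rewrite ?paramsE.
have upper_b : KSc U b (f i) <= l + cW.
  have [[q [sq Uq]] _] := KScP hU b [::].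
  have [|q' sq' Uq'] := hW q (f i) b.
    have /eSt ev := (UE _ _ _).1 Uq.
    apply: ev_comp ev; apply: ev_pair; constructor.
  by apply: leq_trans (KSc_min hU Uq') _; rewrite /l /KS -sq.
(* The extra 1 comes from counting all programs of length at most [m], which are fewer than
   [2 ^ m.+1]. *)
have upper_a : KSc U b (f i) <= m.+1 + 2 * trunc_log 2 u + cQ.
  have [[q [sq Uq]] _] := KScP hU a [::].
  have [s hs] := (UE _ _ _).1 Uq.
  apply: (hQ (maxn s0 s)) => [|s' l' ul hl]; last first.
    by have := decode_prog_card hg ul hl; rewrite !paramsE.
  apply/hasP; exists (enc q).
    have : size q <= m by rewrite sq.
    by rewrite size_enc_le mem_iota !paramsE /=; lia.
  rewrite (mSt s _ _ _ (leq_maxr _ _) hs) /=; apply: dec_f; rewrite ?paramsE //.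
  exact: leq_maxl.
split; first by lia.
split=> //; rewrite addn_minl leq_min; apply/andP; split; lia.
Qed.
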